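(* Let $d\ge 2$ and $m\in\{1,\dots,d-1\}$. The dented pentagram map $T_m$ on both twisted and closed $n$-gons in $\mathbb{CP}^d$ is an integrable system in the sense that it admits a Lax representation with a spectral parameter. In particular, if $\gcd(n,d+1)=1$, such a representation is $$L_{j,t+1}(\lambda)=P_{j+1,t}(\lambda)\,L_{j,t}(\lambda)\,P_{j,t}^{-1}(\lambda)$$ with an appropriate matrix $P_{j,t}(\lambda)$ and with the Lax matrix $$L_{j,t}(\lambda)=\left(\begin{array}{c|c}0\ \cdots\ 0 & (-1)^d\\ \hline D(\lambda) & \begin{array}{c}a_{j,1}\\ a_{j,2}\\ \vdots\\ a_{j,d}\end{array}\end{array}\right)^{-1},$$ where $D(\lambda)=\mathrm{diag}(1,\dots,1,\lambda,1,\dots,1)$ is the diagonal $d\times d$ matrix with the spectral parameter $\lambda$ situated at the $(m+1)$th place, and $a_{j,1},\dots,a_{j,d}$ are the coordinates of the polygon at time $t$.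
   Context: A twisted $n$-gon in $\mathbb{CP}^d$ with monodromy $M\in SL_{d+1}(\mathbb C)$ is a sequence $(v_k)_{k\in\mathbb Z}$ of points of $\mathbb{CP}^d$ with $v_{k+n}=Mv_k$ for all $k$; it is closed if $v_{k+n}=v_k$ for all $k$. Polygons are assumed generic (no $d+1$ consecutive vertices lie in one hyperplane; all the intersections used below are points) and are considered up to projective equivalence, i.e. the action of $SL_{d+1}(\mathbb C)$. All maps are generically defined. Dented pentagram map: for $1\le m\le d-1$ let $P_k$ be the hyperplane through the $d$ vertices $v_k,\dots,v_{k+m-1},v_{k+m+1},\dots,v_{k+d}$ (all vertices from $v_k$ to $v_{k+d}$ except $v_{k+m}$). Then $T_mv_k:=P_k\cap P_{k+1}\cap\dots\cap P_{k+d-1}$. Coordinates: if $\gcd(n,d+1)=1$, the vertices $v_k$ lift to vectors $V_k\in\mathbb C^{d+1}$ with $\det(V_j,V_{j+1},\dots,V_{j+d})=1$ and $V_{j+n}=MV_j$ for all $j\in\mathbb Z$. They satisfy $V_{j+d+1}=a_{j,d}V_{j+d}+a_{j,d-1}V_{j+d-1}+\dots+a_{j,1}V_{j+1}+(-1)^dV_j$ with coefficients $n$-periodic in $j$; the $a_{j,k}$ ($0\le j\le n-1$, $1\le k\le d$) are well-defined coordinates on the space of twisted $n$-gons. Lax representation: a (discrete) Lax representation with a spectral parameter of such a map is a representation of its dynamics in the form $L_{j,t+1}(\lambda)=P_{j+1,t}(\lambda)L_{j,t}(\lambda)P_{j,t}^{-1}(\lambda)$, where $t$ is the discrete time (number of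 iterations of the map), $j$ is the vertex index, $\lambda$ is a complex spectral parameter (coming from a scaling invariance of the map), $L_{j,t}(\lambda)$ is a matrix determined by the polygon at time $t$, and $L_{j,t}(\lambda)$, $P_{j,t}(\lambda)$ are invertible (for generic $\lambda$) and $n$-periodic in $j$. *)

(* Defs.v *)
From HB Require Import structures.
From mathcomp Require Import all_boot all_order all_algebra.
From mathcomp Require Import boolp classical_sets cardinality reals.
From mathcomp Require Export complex.

Set Implicit Arguments.
Unset Strict Implicit.
Unset Printing Implicit Defensive.

Import GRing.Theory.
Local Open Scope ring_scope.

(* A point of the projective space CP^d is a line in C^(d+1).  A polygon is    *)
(* recorded together with its monodromy, because a sequence of points with     *)
(* v_(k+n) = M v_k need not determine M in SL_(d+1).                           *)
Record polygon (C : fieldType) (d : nat) := Polygon {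
  vertex : int -> {vspace 'cV[C]_d.+1};
  monodromy : 'M[C]_d.+1 }.

Definition twisted_ngon (C : fieldType) (d n : nat) (p : polygon C d) : Prop :=
  [/\ \det (monodromy p) = 1,
      forall k, \dim (vertex p k) = 1%N
    & forall k, vertex p (k + n%:Z)
                = (linfun (mulmx (monodromy p)) @: vertex p k)%VS].

Definition closed_ngon (C : fieldType) (d n : nat) (p : polygon C d) : Prop :=
  twisted_ngon n p /\ forall k, vertex p (k + n%:Z) = vertex p k.

Definition proj_equiv (C : fieldType) (d : nat) (p q : polygon C d) : Prop :=
  exists g : 'M[C]_d.+1,
    [/\ \det g = 1,
        forall k, vertex q k = (linfun (mulmx g) @: vertex p k)%VS
      & monodromy q = g *m monodromy p *m invmx g].

(* The hyperplane P_k, as a linear subspace. *)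
Definition dented_plane (C : fieldType) (d m : nat) (p : polygon C d) (k : int) :
    {vspace 'cV[C]_d.+1} :=
  (\sum_(i < d.+1 | i != m :> nat) vertex p (k + i%:Z))%VS.

Definition dented (C : fieldType) (d m : nat) (p : polygon C d) : polygon C d :=
  Polygon (fun k => (\bigcap_(i < d) dented_plane m p (k + i%:Z))%VS)
          (monodromy p).

(* The hyperplanes P_k automatically have dimension d under the first clause. *)
Definition generic_polygon (C : fieldType) (d m : nat) (p : polygon C d) : Prop :=
  (forall k, (\sum_(i < d.+1) vertex p (k + i%:Z))%VS = fullv) /\
  (forall k, \dim (vertex (dented m p) k) = 1%N).

Definition lift (C : fieldType) (d n : nat) (p : polygon C d)
    (V : int -> 'cV[C]_d.+1) : Prop :=
  (forall k, vertex p k = <[V k]>%VS) /\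
  (forall k, V (k + n%:Z) = monodromy p *m V k).

(* [a j] is the column (a_{j,1}, ..., a_{j,d}). *)
Definition coordinates (C : fieldType) (d n : nat) (p : polygon C d)
    (a : int -> 'cV[C]_d) : Prop :=
  exists V : int -> 'cV[C]_d.+1,
    [/\ lift n p V,
        forall j, \det (\matrix_(r < d.+1, i < d.+1) V (j + i%:Z) r 0) = 1
      & forall j, V (j + d.+1%:Z)
          = \sum_(i < d) a j i 0 *: V (j + i.+1%:Z) + (-1) ^+ d *: V j].

(* Meaningful when gcd(n, d+1) = 1: a generic twisted n-gon then has exactly   *)
(* one system of coordinates.                                                  *)
Definition ngon_coord (C : fieldType) (d n : nat) (p : polygon C d) :
    int -> 'cV[C]_d :=
  xget (fun=> 0) [set a | coordinates n p a]%classic.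

(* Coefficients for an arbitrary quasi-periodic lift.  They exist for every n  *)
(* and are unique up to the gauge V_j -> c_j V_j with c n-periodic.            *)
Definition coefficients (C : fieldType) (d n : nat) (p : polygon C d)
    (a : int -> 'cV[C]_d.+1) : Prop :=
  exists2 V : int -> 'cV[C]_d.+1, lift n p V
    & forall j, V (j + d.+1%:Z) = \sum_(i < d.+1) a j i 0 *: V (j + i%:Z).

Definition scaled (C : fieldType) (d n : nat) (w : 'I_d.+1 -> int) (c : C)
    (p q : polygon C d) : Prop :=
  exists a b : int -> 'cV[C]_d.+1,
    [/\ coefficients n p a, coefficients n q b
      & forall j i, b j i 0 = c ^ w i * a j i 0].

(* On generic polygons the scaling by w is defined for every c != 0 and        *)
(* commutes with T_m.                                                          *)
Definition scaling_invariant (C : fieldType) (d m n : nat)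
    (w : 'I_d.+1 -> int) : Prop :=
  forall (c : C) (p : polygon C d), c != 0 ->
    twisted_ngon n p -> generic_polygon m p -> generic_polygon m (dented m p) ->
    (exists q, [/\ twisted_ngon n q, generic_polygon m q & scaled n w c p q]) /\
    (forall q, twisted_ngon n q -> generic_polygon m q -> scaled n w c p q ->
       scaled n w c (dented m p) (dented m q)).

Definition for_generic (C : fieldType) (Q : C -> Prop) : Prop :=
  finite_set [set l | ~ Q l]%classic.

Definition rational_mx (C : fieldType) (k : nat) (A : C -> 'M[C]_k) : Prop :=
  forall r s, exists p q : {poly C},
    q != 0 /\ forall l, q.[l] != 0 -> A l r s = p.[l] / q.[l].

(* n-periodic in j, rational in the spectral parameter and generically         *)
(* invertible.                                                                 *)
Definition spectral_family (C : fieldType) (d n : nat)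
    (A : int -> C -> 'M[C]_d.+1) : Prop :=
  [/\ forall j l, A (j + n%:Z) l = A j l,
      forall j, rational_mx (A j)
    & for_generic (fun l => forall j, A j l \in unitmx)].

Definition gauge_equiv (C : fieldType) (d n : nat)
    (A B : int -> 'M[C]_d.+1) : Prop :=
  exists (s : C) (g : int -> 'M[C]_d.+1),
    [/\ s != 0, forall j, g j \in unitmx, forall j, g (j + n%:Z) = g j
      & forall j, A j = s *: (g (j + 1) *m B j *m invmx (g j))].

(* L is a Lax representation with a spectral parameter of the dented map T_m   *)
(* on the class X of n-gons; [L p j l] is the Lax matrix of the polygon p.     *)
Record lax_representation (C : fieldType) (d m n : nat)
    (X : polygon C d -> Prop)
    (L : polygon C d -> int -> C -> 'M[C]_d.+1) : Prop := LaxRepresentation {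
  lax_family : forall p, X p -> generic_polygon m p -> spectral_family n (L p);
  (* a representation of the dynamics: L encodes exactly the polygon up to     *)
  (* projective equivalence                                                    *)
  lax_faithful : forall p q, X p -> generic_polygon m p ->
    X q -> generic_polygon m q ->
    (proj_equiv p q <-> forall j l, L p j l = L q j l);
  (* the equation along the orbit of p, as long as the orbit is defined        *)
  lax_equation : forall p, X p ->
    exists P : nat -> int -> C -> 'M[C]_d.+1, forall t,
      (forall s, (s <= t.+1)%N -> generic_polygon m (iter s (dented m) p)) ->
      spectral_family n (P t) /\
      for_generic (fun l => forall j,
        L (iter t.+1 (dented m) p) j l
        = P t (j + 1) l *m L (iter t (dented m) p) j l *m invmx (P t j l));
  (* the spectral parameter l = c ^ e comes from a scaling invariance of T_m;  *)
  (* scaling need not preserve closedness, hence q is only twisted             *)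
  lax_scaling : exists (w : 'I_d.+1 -> int) (e : nat),
    [/\ (exists i, w i != 0), (0 < e)%N, scaling_invariant C m n w
      & forall (c : C) p q, c != 0 -> X p -> generic_polygon m p ->
          twisted_ngon n q -> generic_polygon m q -> scaled n w c p q ->
          gauge_equiv n (fun j => L p j (c ^+ e)) (fun j => L q j 1)] }.

Definition spectral_diag (C : fieldType) (d m : nat) (l : C) : 'M[C]_d :=
  diag_mx (\row_(i < d) if i == m :> nat then l else 1).

Definition lax_matrix (C : fieldType) (d m : nat) (a : 'cV[C]_d) (l : C) :
    'M[C]_d.+1 :=
  invmx (castmx (erefl, addn1 d)
    (block_mx (0 : 'rV[C]_d)     ((-1) ^+ d)%:M
              (spectral_diag d m l) a : 'M[C]_(1 + d, d + 1))).

(* Main.v *)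
Require Import Defs.
From mathcomp Require Import all_boot all_order all_algebra reals.
From mathcomp Require Import boolp classical_sets cardinality.
From mathcomp Require Import zify ring.

Set Implicit Arguments.
Unset Strict Implicit.
Unset Printing Implicit Defensive.

Import GRing.Theory.
Local Open Scope ring_scope.

(** The dented map has an explicit inverse, and everything follows from it.

    Write a lift W of an n-gon as a solution of the recurrence
    W_(j+d+1) = b_(j,0) W_j + ... + b_(j,d) W_(j+d) and cut the recurrence at m.
    With (low b W)_j = sum_(i <= m) b_(j,i) W_(j+i) and
    (high b W)_j = W_(j+d+1) - sum_(m < i <= d) b_(j,i) W_(j+i), it says
    high b W = low b W.  The common value lies both in the span of
    W_j, ..., W_(j+m) and in the span of W_(j+m+1), ..., W_(j+d+1), and the
    intersection of these two subspaces is a line.  By duality it is the vertex of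
    index j + m + d of the polygon that T_m maps to <W> ([low_dented]); conversely
    <W> is the image of the polygon of the vectors low b W ([dented_vertex]).

    The spectral parameter deforms the recurrence into high b X = l low b X.  Its
    companion matrix is, up to conjugation by diag(l, ..., l, 1, ..., 1), the
    inverse of the Lax matrix.  Let a be the coefficients of V = low b W.  Then the
    operators satisfy high_a low_b = low_a high_b ([refactorization]): both sides
    involve a window of d + 1 terms only, on such a window every sequence is a
    linear image of W, and for W the identity is the recurrence of V.  This identity
    does not mention l, so low b maps the solutions for (b, l) to the solutions
    for (a, l), for every l at once ([low_solves]), and its kernel is trivial as soon
    as l != 0 ([low_frame_unit]).  In terms of fundamental solutions this map is the
    matrix that conjugates the two Lax matrices, which gives the Lax equation
    ([lax_step]); it is rational in l since the fundamental solutions are.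

    For l = c ^ (d + 1), multiplying the j-th vector by c ^ j turns solutions of the
    recurrence with coefficients scaled by c ^ w_i into solutions of the deformed one,
    where w_i = i for i <= m and w_i = i - (d + 1) for i > m
    ([scale_coef_solves]).  So the same statement says that T_m commutes
    with this scaling ([dented_scaling_invariant]).

    Finally the coefficients determine the polygon up to projective equivalence
    ([coefficients_faithful]), and if n and d + 1 are coprime a lift can be
    normalised to have all its determinants equal to 1 ([coordinates_exist]), which
    forces b_(j,0) = (-1) ^ d.  All the requirements on a Lax representation are
    inherited by smaller classes of polygons, so closed polygons come for free. *)

(** * Companion matrices and the deformed recurrence *)

Lemma int_step_ind (P : int -> Prop) :
    P 0 -> (forall j, P j <-> P (j + 1)) -> forall j, P j.
Proof.
move=> P0 PS; elim/int_rect => // k Pk.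
  by have /PS : P (k%:Z) by []; rewrite -addn1 PoszD.
by apply/PS; have -> : - k.+1%:Z + 1 = - k%:Z by lia.
Qed.

Section Companion.
Variables (C : fieldType) (d m : nat).
Implicit Types (a : 'cV[C]_d.+1) (b : int -> 'cV[C]_d.+1) (l : C) (j : int).

Definition lax_inverse (a : 'cV[C]_d.+1) l : 'M[C]_d.+1 :=
  \matrix_(r, s) if s == d :> nat then a r 0
                 else if r == s.+1 :> nat then (if s == m :> nat then l else 1)
                 else 0.

(** The companion matrix of the recurrence high b X = l low b X: it moves the window
    X_j, ..., X_(j+d) to the next one, see [solvesE]. *)
Definition shift_mx l (a : 'cV[C]_d.+1) : 'M[C]_d.+1 :=
  \matrix_(r, s) if s == d :> nat then (if (r <= m)%N then l else 1) * a r 0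
                 else (r == s.+1 :> nat)%:R.

(** Conjugation by this matrix concentrates the powers of l, which [shift_mx] has in
    its last column, in the single entry of the diagonal block where the Lax matrix
    has them. *)
Definition spectral_gauge l : 'M[C]_d.+1 :=
  diag_mx (\row_(r < d.+1) if (r <= m)%N then l else 1).

Lemma mul_diag_entry k (v : 'rV[C]_k) (A : 'M[C]_k) r s :
  (diag_mx v *m A) r s = v 0 r * A r s.
Proof. by rewrite mul_diag_mx mxE. Qed.

Lemma mul_entry_diag k (v : 'rV[C]_k) (A : 'M[C]_k) r s :
  (A *m diag_mx v) r s = A r s * v 0 s.
Proof. by rewrite mul_mx_diag mxE. Qed.

Lemma diag_mx_unit k (v : 'rV[C]_k) :
  (forall i, v 0 i != 0) -> diag_mx v \in unitmx.
Proof.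
move=> v0; rewrite unitmxE det_diag unitfE; apply/prodf_neq0 => i _.
exact: v0.
Qed.

Lemma spectral_gauge_unit l : l != 0 -> spectral_gauge l \in unitmx.
Proof.
by move=> l0; apply: diag_mx_unit => i; rewrite mxE; case: ifP; rewrite ?oner_neq0.
Qed.

Lemma shift_mx_gauge l a : (m < d)%N ->
  shift_mx l a *m spectral_gauge l = spectral_gauge l *m lax_inverse a l.
Proof.
move=> hm; apply/matrixP => r s; rewrite mul_entry_diag mul_diag_entry !mxE.
have [sd|sd] := eqVneq (s : nat) d.
  by rewrite [(s <= m)%N]leqNgt sd hm mulr1.
have [rs|rs] := eqVneq (r : nat) s.+1; last by rewrite mul0r mulr0.
rewrite rs mul1r; have [->|sm] := eqVneq (s : nat) m; first by rewrite leqnn ltnn mul1r.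
rewrite mulr1; congr (if _ then _ else _); rewrite ltn_neqAle sm; lia.
Qed.

(** The first row has a single nonzero entry, in the last column, and its minor is the
    diagonal block, of determinant l. *)
Lemma det_lax_inverse a l : (m < d)%N ->
  \det (lax_inverse a l) = (-1) ^+ d * a 0 0 * l.
Proof.
move=> hm; rewrite (expand_det_row _ ord0) (bigD1 ord_max) //= big1 ?addr0; last first.
  move=> s sd; rewrite mxE ifN ?mul0r //.
rewrite mxE eqxx /cofactor add0n mulrCA -mulrA; congr (_ * (_ * _)).
have -> : row' ord0 (col' ord_max (lax_inverse a l))
    = diag_mx (\row_(i < d) if i == m :> nat then l else 1).
  apply/matrixP => r s; rewrite !mxE /= /bump leqNgt ltn_ord !add0n ltn_eqF //=.
  rewrite add1n eqSS -val_eqE /=.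
  by have [->|//] := eqVneq (r : nat) s; rewrite mulr1n.
rewrite det_diag (bigD1 (Ordinal hm)) //= mxE eqxx big1 ?mulr1 // => i im.
by rewrite mxE ifN.
Qed.

Lemma det_shift_mx l a : (m < d)%N -> l != 0 ->
  \det (shift_mx l a) = (-1) ^+ d * a 0 0 * l.
Proof.
move=> hm l0; rewrite -(det_lax_inverse a l hm).
have gu := spectral_gauge_unit l0.
have := congr1 determinant (shift_mx_gauge l a hm).
rewrite !det_mulmx mulrC => /mulfI; apply.
by move: gu; rewrite unitmxE unitfE.
Qed.

Lemma shift_mx_unit l a : (m < d)%N -> l != 0 -> a 0 0 != 0 ->
  shift_mx l a \in unitmx.
Proof.
move=> hm l0 a0; rewrite unitmxE det_shift_mx // unitfE !mulf_neq0 //.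
by rewrite expf_neq0 // oppr_eq0 oner_neq0.
Qed.

Lemma lax_inverse_unit l a : (m < d)%N -> l != 0 -> a 0 0 != 0 ->
  lax_inverse a l \in unitmx.
Proof.
move=> hm l0 a0; rewrite unitmxE det_lax_inverse // -(det_shift_mx _ hm l0) -unitmxE.
exact: shift_mx_unit.
Qed.

(** The vectors are indexed by all integers and may have any dimension k: the cases
    k = d + 1 (lifts) and k = 1 (linear forms applied to a lift) are both needed. *)
Definition frame k (X : int -> 'cV[C]_k) j : 'M[C]_(k, d.+1) :=
  \matrix_(r, i) X (j + i%:Z) r 0.

(** [low] and [high] are the two halves of the recurrence of [b], cut after the
    term of index m. *)
Definition low b k (X : int -> 'cV[C]_k) j :=
  \sum_(i < d.+1 | (i <= m)%N) b j i 0 *: X (j + i%:Z).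

Definition high b k (X : int -> 'cV[C]_k) j :=
  X (j + d.+1%:Z) - \sum_(i < d.+1 | ~~ (i <= m)%N) b j i 0 *: X (j + i%:Z).

Definition solves l b k (X : int -> 'cV[C]_k) :=
  forall j, high b X j = l *: low b X j.

Lemma solvesE l b k (X : int -> 'cV[C]_k) :
  solves l b X <-> forall j, frame X (j + 1) = frame X j *m shift_mx l (b j).
Proof.
have colE j : X (j + d.+1%:Z) = high b X j
    + \sum_(i < d.+1 | ~~ (i <= m)%N) b j i 0 *: X (j + i%:Z).
  by rewrite /high subrK.
have sumE j r : \sum_(i < d.+1) X (j + i%:Z) r 0 * ((if (i <= m)%N then l else 1) * b j i 0)
    = (l *: low b X j + \sum_(i < d.+1 | ~~ (i <= m)%N) b j i 0 *: X (j + i%:Z)) r 0.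
  rewrite (bigID (fun i : 'I__ => (i <= m)%N)) /= !mxE !summxE mulr_sumr.
  congr (_ + _); apply: eq_bigr => i im; rewrite !mxE ?im ?(negPf im).
    by rewrite mulrCA; congr (_ * _); rewrite mulrC.
  by rewrite mul1r mulrC.
split=> H j; last first.
  apply: (addIr (\sum_(i < d.+1 | ~~ (i <= m)%N) b j i 0 *: X (j + i%:Z))).
  rewrite -colE; apply/colP => r; rewrite -sumE.
  have := congr1 (fun A : 'M_(_, _) => A r ord_max) (H j); rewrite !mxE.
  have -> : j + 1 + d%:Z = j + d.+1%:Z by lia.
  by move=> ->; apply: eq_bigr => i _; rewrite !mxE eqxx.
apply/matrixP => r s; rewrite !mxE.
have [sd|sd] := eqVneq (s : nat) d.
  under eq_bigr do rewrite !mxE sd eqxx.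
  by rewrite sumE -H -colE sd; congr (X _ _ _); lia.
have ss : (s.+1 < d.+1)%N by have := ltn_ord s; lia.
rewrite (bigD1 (Ordinal ss)) //= big1 ?addr0; last first.
  by move=> i; rewrite -val_eqE /= => ne; rewrite !mxE (negPf sd) (negPf ne) mulr0.
by rewrite !mxE (negPf sd) eqxx mulr1 /=; congr (X _ _ _); lia.
Qed.


(** A recurrence F_(j+1) = F_j A_j over all integers is solved from j = 0 in both
    directions; [forward_product] and [backward_product] are the two halves.  They are
    explicit products, so that they are visibly rational in a parameter of A. *)
Fixpoint forward_product (A : int -> 'M[C]_d.+1) (k : nat) : 'M[C]_d.+1 :=
  if k is k'.+1 then forward_product A k' *m A k' else 1%:M.

Fixpoint backward_product (A : int -> 'M[C]_d.+1) (k : nat) : 'M[C]_d.+1 :=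
  if k is k'.+1 then backward_product A k' *m invmx (A (Negz k')) else 1%:M.

Definition transport (A : int -> 'M[C]_d.+1) j : 'M[C]_d.+1 :=
  match j with Posz k => forward_product A k | Negz k => backward_product A k.+1 end.

Lemma transportS (A : int -> 'M[C]_d.+1) j : (forall i, A i \in unitmx) ->
  transport A (j + 1) = transport A j *m A j.
Proof.
move=> Au; case: j => k; first by rewrite -PoszD addn1.
have -> : Negz k + 1 = - k%:Z by lia.
by case: k => [|k]; rewrite -?NegzE /= mulmxKV.
Qed.

Lemma transport_unit (A : int -> 'M[C]_d.+1) : (forall i, A i \in unitmx) ->
  forall j, transport A j \in unitmx.
Proof.
move=> Au; apply: int_step_ind => [|j]; first exact: unitmx1.
by rewrite transportS // unitmx_mul Au andbT.
Qed.

Lemma transport_unique k (A : int -> 'M[C]_d.+1) (F : int -> 'M[C]_(k, d.+1)) :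
    (forall i, A i \in unitmx) -> (forall j, F (j + 1) = F j *m A j) ->
  forall j, F j = F 0 *m transport A j.
Proof.
move=> Au FS; apply: int_step_ind => [|j]; first by rewrite mulmx1.
rewrite FS transportS // mulmxA; split=> [->//|E].
by rewrite -[LHS](mulmxK (Au j)) E mulmxK.
Qed.

Lemma frame_mul p k (f : 'M[C]_(p, k)) (X : int -> 'cV[C]_k) j :
  frame (fun i => f *m X i) j = f *m frame X j.
Proof. by apply/matrixP => r i; rewrite !mxE; apply: eq_bigr => s _; rewrite mxE. Qed.

Lemma frame_inj k (X Y : int -> 'cV[C]_k) :
  frame X =1 frame Y -> forall j, X j = Y j.
Proof.
move=> E j; apply/colP => r; have := congr1 (fun A : 'M_(_, _) => A r 0) (E j).
by rewrite !mxE addr0.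
Qed.

Lemma frame_combination k (X : int -> 'cV[C]_k) j (v : 'cV[C]_d.+1) :
  frame X j *m v = \sum_(i < d.+1) v i 0 *: X (j + i%:Z).
Proof.
apply/colP => r; rewrite mxE summxE; apply: eq_bigr => i _.
by rewrite !mxE mulrC.
Qed.

Lemma low_mul b p k (f : 'M[C]_(p, k)) (X : int -> 'cV[C]_k) j :
  low b (fun i => f *m X i) j = f *m low b X j.
Proof. by rewrite mulmx_sumr; apply: eq_bigr => i _; rewrite scalemxAr. Qed.

Lemma high_mul b p k (f : 'M[C]_(p, k)) (X : int -> 'cV[C]_k) j :
  high b (fun i => f *m X i) j = f *m high b X j.
Proof.
rewrite /high mulmxBr mulmx_sumr; congr (_ - _).
by apply: eq_bigr => i _; rewrite scalemxAr.
Qed.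

Lemma solves_mul l b p k (f : 'M[C]_(p, k)) (X : int -> 'cV[C]_k) :
  solves l b X -> solves l b (fun i => f *m X i).
Proof. by move=> sX j; rewrite high_mul low_mul sX scalemxAr. Qed.

Section Solutions.
Hypothesis hm : (m < d)%N.

Section FixedParameter.
Variables (l : C) (b : int -> 'cV[C]_d.+1).
Hypotheses (l0 : l != 0) (b0 : forall j, b j 0 0 != 0).

Let shift_unit j : shift_mx l (b j) \in unitmx.
Proof. exact: shift_mx_unit. Qed.

Lemma solution_unique k (X Y : int -> 'cV[C]_k) j0 :
    solves l b X -> solves l b Y -> frame X j0 = frame Y j0 ->
  forall j, X j = Y j.
Proof.
move=> /solvesE sX /solvesE sY E; apply: frame_inj => j.
have TX := transport_unique shift_unit sX; have TY := transport_unique shift_unit sY.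
rewrite TX TY; congr (_ *m _).
apply: (can_inj (mulmxK (transport_unit shift_unit j0))).
by rewrite -TX -TY.
Qed.

(** A solution with one invertible window is a basis of the space of all solutions. *)
Lemma solution_factor k (W : int -> 'cV[C]_d.+1) (X : int -> 'cV[C]_k) j0 :
    solves l b W -> frame W j0 \in unitmx -> solves l b X ->
  exists f : 'M[C]_(k, d.+1), forall j, X j = f *m W j.
Proof.
move=> sW Wu sX; exists (frame X j0 *m invmx (frame W j0)).
apply: (@solution_unique _ _ _ j0) => //; first exact: solves_mul.
by rewrite frame_mul mulmxKV.
Qed.

Definition fundamental_solution j : 'cV[C]_d.+1 :=
  col ord0 (transport (fun i => shift_mx l (b i)) j).

(** The first column of the transport matrix determines the others: by the shape of
    the companion matrix, column i at j is the first column at j + i. *)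
Lemma frame_fundamental j :
  frame fundamental_solution j = transport (fun i => shift_mx l (b i)) j.
Proof.
set T := transport _; apply/matrixP => r [i id]; rewrite !mxE /=.
elim: i id j => [|i IHi] id j; first by rewrite addr0; congr (T j r _); apply: val_inj.
have -> : j + i.+1%:Z = j + 1 + i%:Z by lia.
rewrite (IHi (ltnW id)) /T transportS // mxE (bigD1 (Ordinal id)) //=.
rewrite big1 ?addr0; last first.
  by move=> s; rewrite -val_eqE /= => ne; rewrite mxE /= ifN ?(negPf ne) ?mulr0 //; lia.
by rewrite mxE /= eqxx ifN ?mulr1 //; lia.
Qed.

Lemma fundamental_unit j : frame fundamental_solution j \in unitmx.
Proof. by rewrite frame_fundamental transport_unit. Qed.

Lemma fundamental_solves : solves l b fundamental_solution.
Proof. by apply/solvesE => j; rewrite !frame_fundamental transportS. Qed.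

End FixedParameter.

Lemma lead_neq0 b (W : int -> 'cV[C]_d.+1) :
  solves 1 b W -> (forall j, frame W j \in unitmx) -> forall j, b j 0 0 != 0.
Proof.
move=> /solvesE sW Wu j; have := Wu (j + 1).
rewrite sW unitmx_mul => /andP[_]; rewrite unitmxE det_shift_mx ?oner_neq0 //.
by rewrite unitfE mulr1 mulf_eq0 => /norP[].
Qed.

(** The terms of X that occur on both sides have the indices j + m + 1, ..., j + m + d + 1,
    so X can be replaced there by f W with f a constant matrix; and for W both
    sides are given by the recurrences of W and low b W. *)
Lemma refactorization (a b : int -> 'cV[C]_d.+1) (W : int -> 'cV[C]_d.+1) :
    (forall j, frame W j \in unitmx) -> solves 1 b W -> solves 1 a (low b W) ->
  forall k (X : int -> 'cV[C]_k) j, high a (low b X) j = low a (high b X) j.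
Proof.
move=> Wu sW sV k X j; pose j1 := j + m.+1%:Z.
pose f := frame X j1 *m invmx (frame W j1).
have window s : (m < s <= m + d.+1)%N -> X (j + s%:Z) = f *m W (j + s%:Z).
  move=> hs; have hs' : (s - m.+1 < d.+1)%N by lia.
  have : frame X j1 = f *m frame W j1 by rewrite mulmxKV.
  rewrite -frame_mul => /matrixP E; apply/colP => r.
  have := E r (Ordinal hs'); rewrite [LHS]mxE [RHS]mxE /=.
  by have -> : j1 + (s - m.+1)%:Z = j + s%:Z by lia.
have lowE s : (m < s <= d.+1)%N -> low b X (j + s%:Z) = f *m low b W (j + s%:Z).
  move=> hs; rewrite -low_mul; apply: eq_bigr => i im; congr (_ *: _).
  by rewrite -!addrA -!PoszD window //; lia.
have highE s : (s <= m)%N -> high b X (j + s%:Z) = f *m high b W (j + s%:Z).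
  move=> hs; rewrite -high_mul; congr (_ - _).
    by rewrite -!addrA -!PoszD window //; lia.
  apply: eq_bigr => i im; congr (_ *: _).
  by rewrite -!addrA -!PoszD window //; have := ltn_ord i; lia.
have -> : high a (low b X) j = f *m high a (low b W) j.
  rewrite -high_mul; congr (_ - _); first by rewrite lowE //; lia.
  by apply: eq_bigr => i im; rewrite lowE //; have := ltn_ord i; lia.
rewrite sV scale1r -low_mul; apply: eq_bigr => i im.
by rewrite highE // sW scale1r.
Qed.

(** [refactorization] contains no parameter, whence a conclusion for all l
    from hypotheses on l = 1. *)
Lemma low_solves (a b : int -> 'cV[C]_d.+1) (W : int -> 'cV[C]_d.+1) :
    (forall j, frame W j \in unitmx) -> solves 1 b W -> solves 1 a (low b W) ->
  forall l k (X : int -> 'cV[C]_k), solves l b X -> solves l a (low b X).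
Proof.
move=> Wu sW sV l k X sX j; rewrite (refactorization Wu sW sV).
rewrite scaler_sumr; apply: eq_bigr => i _; rewrite sX.
by rewrite !scalerA mulrC.
Qed.

(** The kernel of low b on solutions does not depend on l: if low b Z = 0 and
    high b Z = l low b Z, then high b Z = 0 too, so Z solves the recurrence
    for l = 1, where the kernel is trivial by assumption.  Here Z is a
    linear form v applied to X. *)
Lemma low_frame_unit (a b : int -> 'cV[C]_d.+1) (W : int -> 'cV[C]_d.+1) :
    (forall j, frame W j \in unitmx) -> solves 1 b W ->
    (forall j, frame (low b W) j \in unitmx) -> solves 1 a (low b W) ->
  forall l (X : int -> 'cV[C]_d.+1), l != 0 -> solves l b X ->
    (forall j, frame X j \in unitmx) -> forall j, frame (low b X) j \in unitmx.
Proof.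
move=> Wu sW Vu sV l X l0 sX Xu j.
have b0 := lead_neq0 sW Wu; have a0 := lead_neq0 sV Vu.
have sY := low_solves Wu sW sV sX.
rewrite unitmxE unitfE; apply: contraT => /negPn/det0P[v v0 vY].
pose Z i := v *m X i; have sZ : solves l b Z by exact: solves_mul.
have lowZ i : low b Z i = 0.
  pose O (_ : int) : 'cV[C]_1 := 0.
  rewrite low_mul.
  apply: (solution_unique (X := fun p => v *m low b X p) (Y := O) l0 a0 (j0 := j)).
  - exact: solves_mul.
  - move=> p; rewrite /high /low /O !big1 ?subr0 ?scaler0 // => ? _; exact: scaler0.
  - by rewrite frame_mul vY; apply/matrixP => ? ?; rewrite !mxE.
have sZ1 : solves 1 b Z by move=> i; rewrite sZ lowZ !scaler0.
have [f fE] := solution_factor (oner_neq0 C) b0 (j0 := j) sW (Wu j) sZ1.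
have f0 : f = 0.
  rewrite -[f](mulmxK (Vu j)) -frame_mul -[RHS](mul0mx _ (invmx (frame (low b W) j))).
  congr (_ *m _); apply/matrixP => r i; rewrite mxE -low_mul.
  have <- : low b Z = low b (fun j => f *m W j).
    by congr low; apply/funext => ?; rewrite fE.
  by rewrite lowZ !mxE.
case/eqP: v0; rewrite -[v](mulmxK (Xu j)) -frame_mul.
rewrite -[RHS](mul0mx _ (invmx (frame X j))); congr (_ *m _).
by apply/matrixP => r i; rewrite mxE -/(Z _) fE f0 mul0mx !mxE.
Qed.

End Solutions.
End Companion.

(** * Planes spanned by consecutive vertices *)

Section Geometry.
Variables (C : fieldType) (d : nat).
Implicit Types (b : int -> 'cV[C]_d.+1) (X V W : int -> 'cV[C]_d.+1) (j k : int).

(** Both the planes P_k, which omit one of d + 1 consecutive vertices, and the spans of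
    consecutive vertices are of this form, for P = predC1 m and P = [fun i => i < d]. *)
Definition window_span (P : pred nat) X j : {vspace 'cV[C]_d.+1} :=
  (\sum_(i < d.+1 | P i) <[X (j + i%:Z)%R]>)%VS.

Lemma mem_window (P : pred nat) X j k s :
  P s -> (s <= d)%N -> k = j + s%:Z -> X k \in window_span P X j.
Proof.
move=> Ps sd ->; have sd' : (s < d.+1)%N by [].
apply: (subvP (sumv_sup (Ordinal sd') Ps (subvv _))); exact: memv_line.
Qed.

Lemma window_coord X j (i : 'I_d.+1) : frame d X j \in unitmx ->
  invmx (frame d X j) *m X (j + i%:Z) = delta_mx i 0.
Proof.
move=> Xu; apply: (canLR (mulKmx Xu)); rewrite -colE.
by apply/colP => r; rewrite !mxE.
Qed.

Lemma window_spanP (P : pred nat) X j (x : 'cV[C]_d.+1) :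
    frame d X j \in unitmx -> x \in window_span P X j ->
  forall s : 'I_d.+1, ~~ P s -> (invmx (frame d X j) *m x) s 0 = 0.
Proof.
move=> Xu /memv_sumP[y yP ->] s Ps; rewrite mulmx_sumr summxE big1 // => i Pi.
have /vlineP[c ->] := yP i Pi; rewrite -scalemxAr mxE.
rewrite window_coord // mxE andbT; have [si|_] := eqVneq s i; last by rewrite mulr0.
by rewrite si Pi in Ps.
Qed.

Lemma frame_unitP X j :
  reflect (window_span predT X j = fullv) (frame d X j \in unitmx).
Proof.
apply: (iffP idP) => [Xu|E].
  apply/eqP; rewrite eqEsubv subvf; apply/subvP => x _.
  rewrite -[x](mulKVmx Xu) frame_combination; apply: memv_suml => i _.
  by apply/memvZ/(mem_window _ (s := i)) => //; rewrite -ltnS.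
have comb (x : 'cV[C]_d.+1) : exists v, frame d X j *m v = x.
  have : x \in window_span predT X j by rewrite E memvf.
  case/memv_sumP => y yP ->.
  have yc i : {c | y i = c *: X (j + i%:Z)}.
    by apply/cid; have /vlineP[c ->] := yP i isT; exists c.
  exists (\col_i sval (yc i)); rewrite frame_combination; apply: eq_bigr => i _.
  by rewrite mxE; case: (yc i) => c /= ->.
pose B := \matrix_(r, s) sval (cid (comb (delta_mx s 0))) r 0.
have /mulmx1_unit[//] : frame d X j *m B = 1%:M.
apply/matrixP => r s; have := svalP (cid (comb (delta_mx s 0))).
move/colP/(_ r); rewrite !mxE andbT => <-.
by apply: eq_bigr => i _; rewrite [B _ _]mxE.
Qed.

(** At most d because d lines are summed; at least d because one more line
    gives the whole space. *)
Lemma window_dim (i0 : nat) X j : (i0 <= d)%N -> frame d X j \in unitmx ->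
  \dim (window_span (predC1 i0) X j) = d.
Proof.
move=> hi0 Xu; have hi : (i0 < d.+1)%N by [].
apply/eqP; rewrite eqn_leq; apply/andP; split.
  apply: (leq_trans (dimv_leq_sum _ _ _)).
  have : (\sum_(i < d.+1 | i != i0 :> nat) \dim <[X (j + i%:Z)%R]>
          <= \sum_(i < d.+1 | i != i0 :> nat) 1)%N.
    by apply: leq_sum => i _; rewrite dim_vline leq_b1.
  move/leq_trans; apply.
  have := cardD1 (Ordinal hi) 'I_d.+1; rewrite card_ord inE add1n => -[dE].
  rewrite sum1_card [X in (_ <= X)%N]dE.
  apply/subset_leq_card/fintype.subsetP => i.
  by rewrite !inE -val_eqE /= andbT.
have /frame_unitP E := Xu.
have := dimv_add_leqif <[X (j + i0%:Z)]> (window_span (predC1 i0) X j).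
have -> : (<[X (j + i0%:Z)%R]> + window_span (predC1 i0) X j = fullv)%VS.
  rewrite -E /window_span [RHS](bigD1 (Ordinal hi)) //=; congr (_ + _)%VS.
rewrite dimvf dim_matrix mulr1 => -[H _]; move: H.
by rewrite dim_vline => /leq_trans/(_ (leq_add (leq_b1 _) (leqnn _))); rewrite add1n.
Qed.

Lemma window_dim_last X j : frame d X j \in unitmx ->
  \dim (window_span (fun i => i < d)%N X j) = d.
Proof.
move=> Xu; rewrite -[RHS](window_dim (leqnn d) Xu); congr (\dim _).
by apply: eq_bigl => i /=; have := ltn_ord i; rewrite ltnS ltn_neqAle => ->; rewrite andbT.
Qed.

(** A sequence of planes such that P_(k+d-1) is spanned by W_k, ..., W_(k+d-1).  This is
    the dual description of the image of the dented map: W_k lies in exactly the planes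
    P_k, ..., P_(k+d-1). *)
Section Planes.
Variables (P : int -> {vspace 'cV[C]_d.+1}) (W : int -> 'cV[C]_d.+1).
Hypothesis d0 : (0 < d)%N.
Hypothesis Wu : forall j, frame d W j \in unitmx.
Hypothesis PE : forall k, P (k + d.-1%:Z) = window_span (fun i => i < d)%N W k.

Lemma mem_plane k s : (s < d)%N -> W k \in P (k + s%:Z).
Proof.
move=> sd; have -> : k + s%:Z = k + s%:Z - d.-1%:Z + d.-1%:Z by lia.
rewrite PE; apply: (mem_window _ (s := (d.-1 - s)%N)) => /=; lia.
Qed.

Lemma not_mem_plane k : W (k + d%:Z) \notin P (k + d.-1%:Z).
Proof.
rewrite PE; apply/negP => /(window_spanP (Wu k))/(_ ord_max).
rewrite /= ltnn => /(_ isT).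
by rewrite (window_coord ord_max (Wu k)) mxE !eqxx => /eqP; rewrite oner_eq0.
Qed.

(** Intersecting span(W_k, ..., W_(k+i)) with the plane P_(k+i-1), where i = d - s - 1,
    removes the last generator W_(k+i): that plane contains the others, and it
    does not contain W_(k+i). *)
Lemma plane_descent k x : (forall i, (i < d)%N -> x \in P (k + i%:Z)) ->
  forall s, (s < d)%N -> x \in window_span (fun i => i < d - s)%N W k.
Proof.
move=> xP; elim=> [|s IHs] sd.
  by rewrite subn0 -PE; apply: xP; lia.
have [y yP xE] := memv_sumP (IHs (ltnW sd)).
pose i := (d - s.+1)%N; have id : (i < d.+1)%N by rewrite /i; lia.
have i0 : (0 < i)%N by rewrite /i; lia.
have : x \in P (k - (d - i)%:Z + d.-1%:Z).
  have -> : k - (d - i)%:Z + d.-1%:Z = k + i.-1%:Z by lia.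
  by apply: xP; lia.
have iP : (Ordinal id < d - s)%N by rewrite /= /i; lia.
move: xE; rewrite (bigD1 _ iP) /=.
have /vlineP[c ->] := yP _ iP; set z := \sum_(_ | _) _ => xE.
have zP : z \in window_span (fun i => i < d - s.+1)%N W k.
  apply: memv_suml => r /andP[rd]; rewrite -val_eqE /= => ri.
  have /vlineP[c' ->] := yP _ rd; apply/memvZ/(mem_window _ (s := r)) => //; last first.
    by rewrite -ltnS.
  by move: rd ri; rewrite /i; lia.
have zP' : z \in P (k - (d - i)%:Z + d.-1%:Z).
  rewrite PE; move: z zP {xE}; apply/subvP/subv_sumP => r rd.
  rewrite -memvE; apply: (mem_window _ (s := (r + d - i)%N)); rewrite /i; lia.
rewrite xE rpredDr // => cP.
suff -> : c = 0 by rewrite scale0r add0r.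
apply: contraTeq cP => c0; rewrite rpredZeq (negPf c0) /=.
have -> : k + i%:Z = k - (d - i)%:Z + d%:Z by lia.
exact: not_mem_plane.
Qed.

Lemma bigcap_planes k : (\bigcap_(i < d) P (k + i%:Z)%R)%VS = <[W k]>%VS.
Proof.
apply/eqP; rewrite eqEsubv; apply/andP; split; last first.
  apply/subv_bigcapP => i _; rewrite -memvE; exact: mem_plane.
apply/subvP => x; rewrite memvE => /subv_bigcapP xP.
have : x \in window_span (fun i => i < d - d.-1)%N W k.
  apply: plane_descent; last by lia.
  by move=> i id; rewrite memvE; exact: (xP (Ordinal id)).
have -> : (d - d.-1 = 1)%N by lia.
rewrite /window_span (bigD1 ord0) //= big1 ?addv0 ?addr0 // => i.
by rewrite -val_eqE /=; lia.
Qed.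

Lemma planes_disjoint k x : (forall i, (i <= d)%N -> x \in P (k + i%:Z)) -> x = 0.
Proof.
move=> xP; have : x \in (\bigcap_(i < d) P (k + 1 + i%:Z)%R)%VS.
  rewrite memvE; apply/subv_bigcapP => i _; rewrite -memvE.
  have -> : k + 1 + i%:Z = k + i.+1%:Z by lia.
  exact: xP.
rewrite bigcap_planes => /vlineP[c xE]; apply/eqP.
have := xP 0 (leq0n d); rewrite addr0 xE; apply: contraTT.
rewrite scaler_eq0 => /norP[c0 _]; rewrite rpredZeq (negPf c0) /=.
have := not_mem_plane (k - d.-1%:Z).
have -> : k - d.-1%:Z + d%:Z = k + 1 by lia.
by rewrite subrK.
Qed.

End Planes.
End Geometry.

(** * The inverse of the dented map *)

Section DentedMap.
Variables (C : fieldType) (d m : nat).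
Hypothesis hm : (m < d)%N.
Let d0 : (0 < d)%N := leq_ltn_trans (leq0n m) hm.
Implicit Types (b : int -> 'cV[C]_d.+1) (p q : polygon C d) (V W : int -> 'cV[C]_d.+1).

Lemma dented_planeE p V k : (forall i, vertex p i = <[V i]>%VS) ->
  dented_plane m p k = window_span (predC1 m) V k.
Proof. by move=> pV; apply: eq_bigr => i _; rewrite pV. Qed.

Lemma low_mem_window b W (P : pred nat) j k :
    (forall i, (i <= m)%N -> exists s, [/\ P s, (s <= d)%N & k + i%:Z = j + s%:Z]) ->
  low m b W k \in window_span P W j.
Proof.
move=> H; apply: memv_suml => i im; apply: memvZ.
by have [s [Ps sd E]] := H i im; apply: (mem_window _ Ps sd).
Qed.

Lemma high_mem_window b W (P : pred nat) j k :
    (forall i, (m < i <= d.+1)%N -> exists s, [/\ P s, (s <= d)%N & k + i%:Z = j + s%:Z]) ->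
  high m b W k \in window_span P W j.
Proof.
move=> H; apply: rpredB.
  by have [|s [Ps sd E]] := H d.+1; [lia|apply: (mem_window _ Ps sd)].
apply: memv_suml => i im; apply: memvZ.
have [|s [Ps sd E]] := H i; first by have := ltn_ord i; lia.
exact: (mem_window _ Ps sd).
Qed.

(** The vertex k + i of q is low b W at k + i - m - d, which is a combination of
    W_(k-d+1), ..., W_k for every i != m: by the definition of low if i > m, and
    because l low b W = high b W if i < m.  So the plane P_k of q is
    the span of W_(k-d+1), ..., W_k, and the intersection of d consecutive planes is
    the line of W_k. *)
Lemma dented_vertex l b q W : l != 0 ->
    (forall j, frame d W j \in unitmx) -> solves m l b W ->
    (forall j, frame d (low m b W) j \in unitmx) ->
    (forall k, vertex q (k + (m + d)%:Z) = <[low m b W k]>%VS) ->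
  forall k, vertex (dented m q) k = <[W k]>%VS.
Proof.
move=> l0 Wu sW Vu qV; pose V k := low m b W (k - (m + d)%:Z).
have qV' k : vertex q k = <[V k]>%VS by rewrite /V -qV subrK.
have Vu' k : frame d V k \in unitmx.
  have -> : frame d V k = frame d (low m b W) (k - (m + d)%:Z) => //.
  apply/matrixP => r i; rewrite !mxE /V; congr (low m b W _ _ _); lia.
apply: (bigcap_planes d0 Wu) => k; rewrite (dented_planeE _ qV').
apply/eqP; rewrite eqEdim window_dim_last // window_dim //; last by lia.
rewrite leqnn andbT; apply/subv_sumP => i im; rewrite -memvE.
have id := ltn_ord i; have {im} im : nat_of_ord i != m by [].
have [lt_im|le_mi] := ltnP i m.
  suff : l *: V (k + d.-1%:Z + i%:Z) \in window_span (fun i : nat => i < d)%N W k.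
    by rewrite rpredZeq (negPf l0).
  rewrite /V -sW; apply: high_mem_window => r hr.
  by exists (r + i - m.+1)%N; split=> /=; lia.
apply: low_mem_window => r hr.
by exists (r + i - m.+1)%N; split=> /=; lia.
Qed.

(** By definition of T_m the plane P_k contains W_(k-d+1), ..., W_k, hence is
    spanned by them.
    With K = k + m + d, the vectors V_K and low b W_k both lie in all the planes
    P_(K-i) with i <= d except possibly the one for i = m.  As the intersection of all
    d + 1 of them is 0 and P_(K-m) does not contain V_K, these two vectors
    are proportional. *)
Lemma low_dented b p V W :
    (forall k, vertex p k = <[V k]>%VS) -> (forall j, frame d V j \in unitmx) ->
    (forall k, vertex (dented m p) k = <[W k]>%VS) ->
    (forall j, frame d W j \in unitmx) -> solves m 1 b W ->
  forall k, exists2 u, u != 0 & low m b W k = u *: V (k + (m + d)%:Z).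
Proof.
move=> pV Vu TW Wu sW k.
have PE j : dented_plane m p (j + d.-1%:Z) = window_span (fun i => i < d)%N W j.
  apply/eqP; rewrite eq_sym eqEdim window_dim_last // (dented_planeE _ pV).
  rewrite window_dim //; last by lia.
  rewrite leqnn andbT; apply/subv_sumP => r rd; rewrite -TW /=.
  have rd' : (d.-1 - r < d)%N by lia.
  apply: (bigcapv_inf (Ordinal rd')) => //=.
  have -> : j + r%:Z + (d.-1 - r)%:Z = j + d.-1%:Z by lia.
  by rewrite (dented_planeE _ pV).
set U := low m b W k; set K := k + (m + d)%:Z.
have UP i : (i <= d)%N -> i != m -> U \in dented_plane m p (K - i%:Z).
  move=> id im.
  have -> : K - i%:Z = k + (m.+1)%:Z - i%:Z + d.-1%:Z by rewrite /K; lia.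
  rewrite PE; have [lt_im|le_mi] := ltnP i m.
    rewrite /U -[low _ _ _ _]scale1r -sW; apply: high_mem_window => r hr.
    by exists (r + i - m.+1)%N; split=> /=; lia.
  apply: low_mem_window => r hr.
  by exists (r + i - m.+1)%N; split=> /=; lia.
have VP i : (i <= d)%N -> i != m -> V K \in dented_plane m p (K - i%:Z).
  move=> id im; rewrite (dented_planeE _ pV); apply: (mem_window _ (s := i)) => //.
  by rewrite subrK.
have : U \in (<[V K]> + dented_plane m p (K - m%:Z))%VS.
  have md : (m < d.+1)%N by lia.
  suff -> : (<[V K]> + dented_plane m p (K - m%:Z) = fullv)%VS by exact: memvf.
  have /frame_unitP <- := Vu (K - m%:Z).
  rewrite /window_span (bigD1 (Ordinal md)) //= subrK; congr (_ + _)%VS.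
  by rewrite (dented_planeE _ pV); apply: eq_bigl => i.
case/memv_addP => _ /vlineP[u ->] [y yP UE].
(* y lies in P_(K-m) and, as U - u V_K, in all the other planes. *)
have y0 : y = 0.
  apply: (planes_disjoint d0 Wu PE (k := K - d%:Z)) => i id.
  have -> : K - d%:Z + i%:Z = K - (d - i)%:Z by lia.
  have [->//|ne] := eqVneq (d - i)%N m.
  have -> : y = U - u *: V K by rewrite UE addrC addKr.
  by apply: rpredB; [apply: UP | apply/memvZ/VP] => //; rewrite leq_subr.
rewrite y0 addr0 in UE; exists u => //.
have b0 := lead_neq0 hm sW Wu.
apply/eqP => u0; move: UE; rewrite u0 scale0r => U0.
(* If U = 0, independence of the window of W at k would give b_(k,0) = 0. *)
pose v : 'cV[C]_d.+1 := \col_i if (i <= m)%N then b k i 0 else 0.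
have Wv : frame d W k *m v = U.
  rewrite frame_combination /U /low [RHS]big_mkcond /=; apply: eq_bigr => i _.
  by rewrite mxE; case: ifP => // _; rewrite scale0r.
have : v = 0 by rewrite -[v](mulKmx (Wu k)) Wv U0 mulmx0.
move/colP/(_ ord0); rewrite !mxE /= => /eqP; exact/negP/b0.
Qed.

End DentedMap.

(** * Rational dependence on the spectral parameter *)

Section Rational.
Variable C : fieldType.

(** The entrywise form of [rational_mx]; a zero of the denominator is an exceptional
    point, where the function may take any value. *)
Definition rational (f : C -> C) :=
  exists p q : {poly C}, q != 0 /\ forall l, q.[l] != 0 -> f l = p.[l] / q.[l].

Lemma rational_ext f g : (forall l, f l = g l) -> rational g -> rational f.
Proof. by move=> fg [p [q [q0 gE]]]; exists p, q; split=> // l ql; rewrite fg gE. Qed.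

Lemma rational_const c : rational (fun=> c).
Proof. by exists c%:P, 1; split=> [|l _]; rewrite ?oner_neq0 // !hornerC divr1. Qed.

Lemma rational_id : rational id.
Proof. by exists 'X, 1; split=> [|l _]; rewrite ?oner_neq0 // hornerX hornerC divr1. Qed.

Lemma rational_add f g : rational f -> rational g -> rational (fun l => f l + g l).
Proof.
move=> [p [q [q0 fE]]] [p' [q' [q0' gE]]].
exists (p * q' + p' * q), (q * q'); split=> [|l]; first by rewrite mulf_neq0.
by rewrite hornerD !hornerM mulf_eq0 => /norP[ql ql']; rewrite fE // gE // addf_div.
Qed.

Lemma rational_mul f g : rational f -> rational g -> rational (fun l => f l * g l).
Proof.
move=> [p [q [q0 fE]]] [p' [q' [q0' gE]]].
exists (p * p'), (q * q'); split=> [|l]; first by rewrite mulf_neq0.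
by rewrite !hornerM mulf_eq0 => /norP[ql ql']; rewrite fE // gE // mulf_div.
Qed.

Lemma rational_inv f : rational f -> rational (fun l => (f l)^-1).
Proof.
move=> [p [q [q0 fE]]]; have [p0|p0] := eqVneq p 0.
  exists 0, q; split=> // l ql; by rewrite fE // p0 horner0 !mul0r invr0.
exists (q * q), (p * q); split=> [|l]; first by rewrite mulf_neq0.
rewrite !hornerM mulf_eq0 => /norP[pl ql]; rewrite fE // invf_div.
by rewrite -mulf_div divff // mulr1.
Qed.

Lemma rational_sum (I : Type) (r : seq I) (P : pred I) (F : I -> C -> C) :
  (forall i, rational (F i)) -> rational (fun l => \sum_(i <- r | P i) F i l).
Proof.
move=> rF; elim: r => [|i r IHr].
  by apply: (rational_ext _ (rational_const 0)) => l; rewrite big_nil.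
apply: rational_ext => [l|]; first by rewrite big_cons.
by case: (P i) => //; apply: rational_add.
Qed.

Lemma rational_prod (I : Type) (r : seq I) (P : pred I) (F : I -> C -> C) :
  (forall i, rational (F i)) -> rational (fun l => \prod_(i <- r | P i) F i l).
Proof.
move=> rF; elim: r => [|i r IHr].
  by apply: (rational_ext _ (rational_const 1)) => l; rewrite big_nil.
apply: rational_ext => [l|]; first by rewrite big_cons.
by case: (P i) => //; apply: rational_mul.
Qed.

Lemma rational_if (b : bool) (f g : C -> C) :
  rational f -> rational g -> rational (fun l => if b then f l else g l).
Proof. by case: b. Qed.

(** All the matrices below are controlled for l != 0 only; multiplying the denominator
    by the variable makes 0 exceptional. *)
Lemma rational_off0 f g : (forall l, l != 0 -> f l = g l) -> rational g -> rational f.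
Proof.
move=> fg [p [q [q0 gE]]]; exists (p * 'X), (q * 'X); split=> [|l].
  by rewrite mulf_neq0 ?polyX_eq0.
rewrite !hornerM hornerX mulf_eq0 => /norP[ql l0].
by rewrite fg // gE // -mulf_div divff // mulr1.
Qed.

Lemma rational_mxM k (A B : C -> 'M[C]_k) :
  rational_mx A -> rational_mx B -> rational_mx (fun l => A l *m B l).
Proof.
move=> rA rB r s; rewrite -/(rational _).
apply: rational_ext => [l|]; first by rewrite mxE.
by apply: rational_sum => i; apply: rational_mul; [exact: rA | exact: rB].
Qed.

Lemma rational_det k (A : C -> 'M[C]_k) :
  rational_mx A -> rational (fun l => \det (A l)).
Proof.
move=> rA; apply: rational_sum => s; apply: rational_mul; first exact: rational_const.
by apply: rational_prod => i; exact: rA.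
Qed.

Lemma rational_mx_off0 k (A B : C -> 'M[C]_k) :
  (forall l, l != 0 -> A l = B l) -> rational_mx B -> rational_mx A.
Proof. by move=> AB rB r s; apply: (rational_off0 _ (rB r s)) => l /AB ->. Qed.

Lemma rational_invmx k (A : C -> 'M[C]_k) :
  (forall l, l != 0 -> A l \in unitmx) -> rational_mx A ->
  rational_mx (fun l => invmx (A l)).
Proof.
move=> Au rA; apply: (@rational_mx_off0 _ _ (fun l => (\det (A l))^-1 *: \adj (A l))).
  by move=> l l0; rewrite /invmx Au.
move=> r s; rewrite -/(rational _); apply: rational_ext => [l|]; first by rewrite !mxE.
apply: rational_mul; first exact/rational_inv/rational_det.
apply: rational_mul; first exact: rational_const.
case: k A Au rA r s => [|k] A Au rA r s; first by case: r.
apply: rational_det => i j; rewrite -/(rational _).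
apply: rational_ext => [l|]; first by rewrite !mxE.
 exact: rA.
Qed.

Lemma rational_entries k (F : C -> 'I_k -> 'I_k -> C) :
  (forall r s, rational (fun l => F l r s)) ->
  rational_mx (fun l => \matrix_(r, s) F l r s).
Proof.
move=> rF r s; rewrite -/(rational _).
by apply: rational_ext (rF r s) => l; rewrite mxE.
Qed.

Lemma generic_off0 (Q : C -> Prop) : (forall l, l != 0 -> Q l) -> for_generic Q.
Proof.
move=> HQ; apply: (@sub_finite_set _ _ [set 0]%classic); last exact: finite_set1.
by move=> l /= nQ; apply/eqP; apply: contra_notT nQ; exact: HQ.
Qed.

End Rational.

Section RationalFamilies.
Variables (C : fieldType) (d m : nat).
Hypothesis hm : (m < d)%N.

Lemma rational_shift_mx (a : 'cV[C]_d.+1) : rational_mx (fun l => shift_mx m l a).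
Proof.
apply: rational_entries => r s.
apply: rational_if; last exact: rational_const.
apply: rational_mul; last exact: rational_const.
by apply: rational_if; [exact: rational_id | exact: rational_const].
Qed.

Lemma rational_lax_inverse (a : 'cV[C]_d.+1) : rational_mx (lax_inverse m a).
Proof.
apply: rational_entries => r s.
apply: rational_if; first exact: rational_const.
apply: rational_if; last exact: rational_const.
by apply: rational_if; [exact: rational_id | exact: rational_const].
Qed.

Lemma rational_spectral_gauge : rational_mx (fun l : C => spectral_gauge d m l).
Proof.
move=> r s; rewrite -/(rational _).
apply: rational_ext => [l|]; first by rewrite !mxE.
case: (r == s); last exact: rational_const.
by apply: rational_if; [exact: rational_id | exact: rational_const].
Qed.

Lemma rational_mx_const k (A : 'M[C]_k) : rational_mx (fun=> A).
Proof. by move=> r s; exact: rational_const. Qed.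

Lemma rational_transport (A : C -> int -> 'M[C]_d.+1) j :
    (forall l j, l != 0 -> A l j \in unitmx) ->
    (forall j, rational_mx (fun l => A l j)) ->
  rational_mx (fun l => transport (A l) j).
Proof.
move=> Au rA; case: j => k.
  rewrite /=; elim: k => [|k IHk] /=; first exact: rational_mx_const.
  exact: rational_mxM.
have B i : rational_mx (fun l => backward_product (A l) i).
  elim: i => [|i IHi] /=; first exact: rational_mx_const.
  by apply: rational_mxM => //; apply: rational_invmx => // l; exact: Au.
exact: (B k.+1).
Qed.

Lemma rational_fundamental (b : int -> 'cV[C]_d.+1) j :
    (forall j, b j 0 0 != 0) ->
  rational_mx (fun l => frame d (fundamental_solution m l b) j).
Proof.
move=> b0; apply: rational_mx_off0 (rational_transport j _ _); last first.
- by move=> i; exact: (rational_shift_mx (b i)).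
- by move=> l i l0; exact: shift_mx_unit.
- by move=> l l0; rewrite frame_fundamental.
Qed.

Lemma rational_low_fundamental (b : int -> 'cV[C]_d.+1) j :
    (forall j, b j 0 0 != 0) ->
  rational_mx (fun l => frame d (low m b (fundamental_solution m l b)) j).
Proof.
move=> b0; apply: rational_entries => r s.
apply: rational_ext => [l|]; first by rewrite summxE.
apply: rational_sum => i; apply: rational_ext => [l|]; first by rewrite mxE.
apply: rational_mul; first exact: rational_const.
set k := j + _ + _; have := rational_fundamental k b0 r ord0; rewrite -/(rational _).
by move=> R; apply: rational_ext R => l; rewrite [RHS]mxE addr0.
Qed.

End RationalFamilies.

(** * Lifts, coefficients and their gauge freedom *)

Section Lifts.
Variables (C : fieldType) (d m n : nat).
Hypotheses (hm : (m < d)%N) (hn : (0 < n)%N).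
Implicit Types (a b : int -> 'cV[C]_d.+1) (p q : polygon C d)
  (V W X : int -> 'cV[C]_d.+1).

Lemma image_line (g : 'M[C]_d.+1) (v : 'cV[C]_d.+1) :
  (linfun (mulmx g) @: <[v]> = <[g *m v]>)%VS.
Proof. by rewrite limg_line lfunE. Qed.

Lemma image_injective (g : 'M[C]_d.+1) :
  g \in unitmx -> lker (linfun (@mulmx C d.+1 d.+1 1 g)) == 0%VS.
Proof.
by move=> gu; apply/lker0P => x y; rewrite !lfunE => /(can_inj (mulKmx gu)).
Qed.

Lemma solves1E a k (X : int -> 'cV[C]_k) :
  solves m 1 a X <-> forall j, X (j + d.+1%:Z) = \sum_(i < d.+1) a j i 0 *: X (j + i%:Z).
Proof.
have E j : \sum_(i < d.+1) a j i 0 *: X (j + i%:Z)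
    = low m a X j + \sum_(i < d.+1 | ~~ (i <= m)%N) a j i 0 *: X (j + i%:Z).
  by rewrite (bigID (fun i : 'I__ => (i <= m)%N)).
split=> H j; have := H j; rewrite scale1r /high E.
  by move/eqP; rewrite subr_eq => /eqP.
by move=> ->; rewrite addrK.
Qed.

Lemma coefficientsE p a :
  coefficients n p a <-> exists2 V : int -> 'cV[C]_d.+1, Defs.lift n p V & solves m 1 a V.
Proof. by split=> -[V Vp] /solves1E; exists V. Qed.

Lemma lift_frame_unit p V : generic_polygon m p -> Defs.lift n p V ->
  forall j, frame d V j \in unitmx.
Proof.
move=> [pg _] [pV _] j; apply/frame_unitP; rewrite -(pg j).
by apply: eq_bigr => i _; rewrite pV.
Qed.

Lemma monodromy_unit p : twisted_ngon n p -> monodromy p \in unitmx.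
Proof. by case=> detM _ _; rewrite unitmxE detM unitr1. Qed.

(** Any choice of vectors on the lines of index 0, ..., n - 1 extends by the
    monodromy. *)
Lemma lift_exists p : twisted_ngon n p -> exists V, Defs.lift n p V.
Proof.
move=> pt; have Mu := monodromy_unit pt; case: pt => detM pd pM.
set M := monodromy p in Mu pM.
have Mu' : M \is a GRing.unit by [].
have n0 : n%:Z != 0 by rewrite eqz_nat -lt0n.
pose V k := M ^ (k %/ n)%Z *m vpick (vertex p (k %% n)%Z).
exists V; split=> k; last first.
  have -> : k + n%:Z = 1 * n%:Z + k by ring.
  rewrite /V divzMDl // modzMDl.
  by rewrite exprzDr // expr1z mulmxA.
have spanP j : vertex p j = <[vpick (vertex p j)]>%VS.
  apply/eqP; rewrite eq_sym eqEdim -memvE memv_pick pd dim_vline.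
  by rewrite vpick0 -dimv_eq0 pd.
rewrite /V {1}(divz_eq k n%:Z) addrC; move: (k %% n)%Z (k %/ n)%Z => r.
apply: int_step_ind => [|z]; first by rewrite mul0r addr0 expr0z mul1mx -spanP.
have -> : r + (z + 1) * n%:Z = r + z * n%:Z + n%:Z by ring.
rewrite pM [z + 1]addrC exprzDr // expr1z.
split=> [->|]; first by rewrite image_line mulmxA.
move=> H; apply/eqP; rewrite -(eq_limg_ker0 _ _ (image_injective Mu)) H.
by rewrite image_line mulmxA.
Qed.

Lemma solution_exists V : (forall j, frame d V j \in unitmx) -> exists a, solves m 1 a V.
Proof.
move=> Vu; exists (fun j => invmx (frame d V j) *m V (j + d.+1%:Z)).
by apply/solves1E => j; rewrite -frame_combination mulKVmx.
Qed.

Lemma coefficients_exist p : twisted_ngon n p -> generic_polygon m p ->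
  exists a, coefficients n p a.
Proof.
move=> pt pg; have [V pV] := lift_exists pt.
have [a sV] := solution_exists (lift_frame_unit pg pV).
by exists a; apply/coefficientsE; exists V.
Qed.

Lemma frame_shift p V : (forall k, V (k + n%:Z) = monodromy p *m V k) ->
  forall j, frame d V (j + n%:Z) = monodromy p *m frame d V j.
Proof.
move=> VM j; rewrite -frame_mul; apply/matrixP => r i; rewrite !mxE.
by rewrite addrAC VM mxE.
Qed.

Lemma coefficients_periodic p a V : (forall k, V (k + n%:Z) = monodromy p *m V k) ->
    (forall j, frame d V j \in unitmx) -> solves m 1 a V ->
  forall j, a (j + n%:Z) = a j.
Proof.
move=> VM Vu /solves1E sV j; apply: (can_inj (mulKmx (Vu (j + n%:Z)))).
rewrite frame_combination -sV addrAC VM sV (frame_shift VM) -mulmxA.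
by rewrite frame_combination.
Qed.

Definition window_diag (u : int -> C) j : 'M[C]_d.+1 :=
  diag_mx (\row_(i < d.+1) u (j + i%:Z)).

Lemma window_diag_unit u j : (forall k, u k != 0) -> window_diag u j \in unitmx.
Proof. by move=> u0; apply: diag_mx_unit => i; rewrite mxE. Qed.

Lemma lift_gauge p V W : twisted_ngon n p ->
    Defs.lift n p V -> Defs.lift n p W ->
  exists u : int -> C, [/\ forall k, u k != 0, forall k, u (k + n%:Z) = u k
                         & forall k, W k = u k *: V k].
Proof.
move=> [_ pd _] [pV VM] [pW WM].
have uE k : {u | W k = u *: V k}.
  apply/cid; have /vlineP[u ->] : W k \in <[V k]>%VS by rewrite -pV pW memv_line.
  by exists u.
have V0 k : V k != 0.
  by apply/eqP => Vk; have := pd k; rewrite pV Vk dim_vline eqxx.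
exists (fun k => sval (uE k)); split=> k; case: (uE _) => /= u E.
- apply/eqP => u0; have := pd k; rewrite pW E u0 scale0r dim_vline eqxx //.
- case: (uE _) => /= v E'; apply/eqP; rewrite -subr_eq0.
  have : (u - v) *: V (k + n%:Z) = 0.
    by rewrite scalerBl -E WM VM E' scalemxAr subrr.
  by move/eqP; rewrite scaler_eq0 (negPf (V0 _)) orbF.
- exact: E.
Qed.

Lemma gauge_coefficients a b V u : (forall j, frame d V j \in unitmx) ->
    solves m 1 a V -> solves m 1 b (fun k => u k *: V k) ->
  forall j (i : 'I_d.+1), u (j + i%:Z) * b j i 0 = u (j + d.+1%:Z) * a j i 0 .
Proof.
move=> Vu /solves1E sV /solves1E sW j i.
have : \col_i (u (j + i%:Z) * b j i 0) = u (j + d.+1%:Z) *: a j.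
  apply: (can_inj (mulKmx (Vu j))); rewrite -scalemxAr !frame_combination -sV.
  rewrite sW; apply: eq_bigr => r _; by rewrite mxE scalerA mulrC.
by move/colP/(_ i); rewrite !mxE.
Qed.

Lemma gauge_solves (a b : int -> 'cV[C]_d.+1) u k (X : int -> 'cV[C]_k) :
    (forall j (i : 'I_d.+1), u (j + i%:Z) * b j i 0 = u (j + d.+1%:Z) * a j i 0) ->
    solves m 1 a X -> solves m 1 b (fun k => u k *: X k).
Proof.
move=> ab /solves1E sX; apply/solves1E => j; rewrite sX scaler_sumr.
by apply: eq_bigr => i _; rewrite !scalerA -ab mulrC.
Qed.

(** Rescaling a lift by u acts on the Lax matrices by a diagonal gauge that does not
    depend on l: the entries l stand below the diagonal, in row s + 1 and column s, and
    u_(j+s+1) is the entry s + 1 of the gauge at j and the entry s of the one at j + 1. *)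
Lemma gauge_lax_inverse (a b : int -> 'cV[C]_d.+1) u l j :
    (forall j (i : 'I_d.+1), u (j + i%:Z) * b j i 0 = u (j + d.+1%:Z) * a j i 0) ->
  window_diag u j *m lax_inverse m (b j) l = lax_inverse m (a j) l *m window_diag u (j + 1).
Proof.
move=> ab; apply/matrixP => r s; rewrite mul_diag_entry mul_entry_diag !mxE.
have [->|sd] := eqVneq (s : nat) d.
  rewrite ab mulrC; congr (_ * u _); clear; lia.
have [->|rs] := eqVneq (r : nat) s.+1; last by rewrite mulr0 mul0r.
rewrite mulrC; congr (_ * u _); clear; lia.
Qed.

(** The inclusion of the image of an intersection in the intersection of the images is
    enough, both sides being lines. *)
Lemma dented_twisted p : twisted_ngon n p -> generic_polygon m p ->
  twisted_ngon n (dented m p).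
Proof.
move=> pt [_ pg]; have Mu := monodromy_unit pt; case: pt => detM pd pM.
split=> // k; apply/eqP; rewrite eq_sym eqEdim pg limg_dim_eq ?pg ?leqnn ?andbT; last first.
  by apply/eqP; rewrite (eqP (image_injective Mu)) capv0.
apply: subv_trans (limg_bigcap _ _ _ _) _; apply/subv_bigcapP => i _.
apply: (bigcapv_inf i) => //=; rewrite /dented_plane limg_sum; apply/subv_sumP => r rm.
apply: (sumv_sup r) => //; rewrite -pM.
have -> : k + n%:Z + i%:Z + r%:Z = k + i%:Z + r%:Z + n%:Z by ring.
exact: subvv.
Qed.

End Lifts.

(** * The Lax equation *)

Section InverseMap.
Variables (C : fieldType) (d m n : nat).
Hypotheses (hm : (m < d)%N) (hn : (0 < n)%N).
Implicit Types (a b : int -> 'cV[C]_d.+1) (p q : polygon C d)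
  (V W X Z : int -> 'cV[C]_d.+1).

Lemma low_shift b k (X : int -> 'cV[C]_k) : (forall j, b (j + n%:Z) = b j) ->
  forall j, low m b X (j + n%:Z) = low m b (fun i => X (i + n%:Z)) j.
Proof.
by move=> bn j; rewrite /low bn; apply: eq_bigr => i _; rewrite addrAC.
Qed.

Lemma high_shift b k (X : int -> 'cV[C]_k) : (forall j, b (j + n%:Z) = b j) ->
  forall j, high m b X (j + n%:Z) = high m b (fun i => X (i + n%:Z)) j.
Proof.
move=> bn j; rewrite /high bn addrAC; congr (_ - _).
by apply: eq_bigr => i _; rewrite [j + n%:Z + _]addrAC.
Qed.

Lemma solves_shift l b k (X : int -> 'cV[C]_k) : (forall j, b (j + n%:Z) = b j) ->
  solves m l b X -> solves m l b (fun i => X (i + n%:Z)).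
Proof. by move=> bn sX j; rewrite -high_shift // -low_shift // sX. Qed.

Lemma line_scale (u : C) (v : 'cV[C]_d.+1) : u != 0 -> (<[u *: v]> = <[v]>)%VS.
Proof.
move=> u0; apply/eqP; rewrite eqEsubv -!memvE; apply/andP; split.
  by apply/memvZ/memv_line.
by rewrite -[v in v \in _](scalerK u0) memvZ ?memv_line.
Qed.

(** The shift by m + d comes from [low_dented].  It is kept out of the recurrence of
    low b W, so that [low_solves] applies as it stands. *)
Record inverse_data p a b W : Prop := InverseData {
  id_lift : Defs.lift n (dented m p) W;
  id_unit : forall j, frame d W j \in unitmx;
  id_solves : solves m 1 b W;
  id_low_unit : forall j, frame d (low m b W) j \in unitmx;
  id_low_solves : solves m 1 a (low m b W);
  id_low_lift : Defs.lift n p (fun k => low m b W (k - (m + d)%:Z));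
  id_periodic : forall j, b (j + n%:Z) = b j;
  id_low_periodic : forall j, a (j + n%:Z) = a j }.

Lemma frame_reindex X s j : frame d (fun k => X (k + s)) j = frame d X (j + s).
Proof. by apply/matrixP => r i; rewrite !mxE addrAC. Qed.

Lemma inverse_data_exists p b : twisted_ngon n p -> generic_polygon m p ->
    generic_polygon m (dented m p) -> coefficients n (dented m p) b ->
  exists a W, inverse_data p a b W.
Proof.
move=> pt pg Tpg /(coefficientsE m) [W WT sW].
have [V pV] := lift_exists hn pt.
have Vu := lift_frame_unit pg pV; have Wu := lift_frame_unit Tpg WT.
have bn := coefficients_periodic WT.2 Wu sW.
have lowE := low_dented hm pV.1 Vu WT.1 Wu sW.
have Llift : Defs.lift n p (fun k => low m b W (k - (m + d)%:Z)).
  split=> k.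
    by rewrite pV.1; case: (lowE (k - (m + d)%:Z)) => u u0 ->; rewrite line_scale ?subrK.
  rewrite addrAC low_shift //.
  have -> : (fun i => W (i + n%:Z)) = (fun i => monodromy p *m W i).
    by apply/funext => i; rewrite (WT.2 i).
  by rewrite low_mul.
have Lu j : frame d (low m b W) j \in unitmx.
  by have := lift_frame_unit pg Llift (j + (m + d)%:Z); rewrite frame_reindex addrK.
have [a sL] := solution_exists m Lu.
exists a, W; split=> //; apply: (coefficients_periodic (p := p) _ Lu sL) => k.
by have := Llift.2 (k + (m + d)%:Z); rewrite addrAC !addrK.
Qed.

Section Data.
Variables (p : polygon C d) (a b : int -> 'cV[C]_d.+1) (W : int -> 'cV[C]_d.+1).
Hypothesis D : inverse_data p a b W.

Let b0 : forall j, b j 0 0 != 0 := lead_neq0 hm (id_solves D) (id_unit D).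
Let a0 : forall j, a j 0 0 != 0 := lead_neq0 hm (id_low_solves D) (id_low_unit D).

Lemma low_coefficients_solves l k (X : int -> 'cV[C]_k) :
  solves m l b X -> solves m l a (low m b X).
Proof. exact: (low_solves hm (id_unit D) (id_solves D) (id_low_solves D)). Qed.

Lemma low_coefficients_unit l X : l != 0 -> solves m l b X ->
    (forall j, frame d X j \in unitmx) -> forall j, frame d (low m b X) j \in unitmx.
Proof.
exact: (low_frame_unit hm (id_unit D) (id_solves D) (id_low_unit D) (id_low_solves D)).
Qed.

(** low b maps a basis of solutions to a basis of solutions. *)
Lemma low_onto l Z : l != 0 -> solves m l a Z -> (forall j, frame d Z j \in unitmx) ->
  exists X, [/\ solves m l b X, forall j, frame d X j \in unitmx & low m b X =1 Z].
Proof.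
move=> l0 sZ Zu; pose F := fundamental_solution m l b.
have Fu j : frame d F j \in unitmx by exact: fundamental_unit.
have sF : solves m l b F by exact: fundamental_solves.
have sL := low_coefficients_solves sF; have Lu := low_coefficients_unit l0 sF Fu.
have [g gE] := solution_factor hm l0 a0 sL (Lu 0) sZ.
have gu : g \in unitmx.
  have := Zu 0; have -> : Z = fun j => g *m low m b F j by apply/funext.
  by rewrite frame_mul unitmx_mul => /andP[].
exists (fun j => g *m F j); split=> [|j|j]; first exact: solves_mul.
  by rewrite frame_mul unitmx_mul gu Fu.
by rewrite low_mul gE.
Qed.

(** Deformed solutions have a monodromy as well, and low b, being periodic, preserves
    it. *)
Lemma solution_monodromy l X : l != 0 -> solves m l b X ->
    (forall j, frame d X j \in unitmx) ->
  exists h : 'M[C]_d.+1, (forall j, X (j + n%:Z) = h *m X j) /\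
                         (forall j, low m b X (j + n%:Z) = h *m low m b X j).
Proof.
move=> l0 sX Xu.
have [h hE] := solution_factor hm l0 b0 sX (Xu 0) (solves_shift (id_periodic D) sX).
exists h; split=> // j; rewrite low_shift; last exact: id_periodic D.
have -> : (fun i => X (i + n%:Z)) = (fun i => h *m X i) by apply/funext.
by rewrite low_mul.
Qed.

(** The columns of F_j^-1 L_(j-m-d), where L = low b F, are the coordinates of a window of
    L in a window of the fundamental solution F; the outer factors pass from the
    companion matrices to the Lax matrices.  The value at l = 0, where the companion
    matrices are singular, only has to be periodic. *)
Definition transition l j : 'M[C]_d.+1 :=
  if l == 0 then 1%:M else
  let F := fundamental_solution m l b in
  invmx (spectral_gauge d m l) *m invmx (frame d F j)
    *m frame d (low m b F) (j - (m + d)%:Z) *m spectral_gauge d m l.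

Lemma transition_unit l j : transition l j \in unitmx.
Proof.
rewrite /transition; have [_|l0] := eqVneq l 0; first exact: unitmx1.
have Fu := fundamental_unit hm l0 b0; have sF := fundamental_solves hm l0 b0.
rewrite !unitmx_mul !unitmx_inv spectral_gauge_unit // Fu.
by rewrite (low_coefficients_unit l0 sF Fu).
Qed.

(** Going around once multiplies F and L on the left by the same
    monodromy, which cancels. *)
Lemma transition_periodic l j : transition l (j + n%:Z) = transition l j.
Proof.
rewrite /transition; have [//|l0] := eqVneq l 0.
set F := fundamental_solution m l b.
have Fu : forall j, frame d F j \in unitmx by exact: fundamental_unit.
have [h [hF hL]] := solution_monodromy l0 (fundamental_solves hm l0 b0) Fu.
have shiftE X : (forall j, X (j + n%:Z) = h *m X j) ->
    forall j, frame d X (j + n%:Z) = h *m frame d X j.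
  move=> hX i; rewrite -frame_mul -frame_reindex; congr (frame d _ i).
  exact/funext.
have hu : h \in unitmx.
  by have := Fu (0 + n%:Z); rewrite (shiftE _ hF) unitmx_mul => /andP[].
congr (_ *m _); rewrite addrAC (shiftE _ hF) (shiftE _ hL) -!mulmxA; congr (_ *m _).
have hFu : h *m frame d F j \in unitmx by rewrite unitmx_mul hu Fu.
by apply: (can_inj (mulKmx hFu)); rewrite mulKVmx // -mulmxA mulKVmx.
Qed.

Lemma transition_rational j : rational_mx (fun l => transition l j).
Proof.
pose F l := fundamental_solution m l b.
apply: (@rational_mx_off0 _ _ _ (fun l => invmx (spectral_gauge d m l)
   *m invmx (frame d (F l) j) *m frame d (low m b (F l)) (j - (m + d)%:Z)
   *m spectral_gauge d m l)).
  by move=> l l0; rewrite /transition (negPf l0).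
apply: rational_mxM; last exact: rational_spectral_gauge.
apply: rational_mxM; last exact: rational_low_fundamental.
apply: rational_mxM; apply: rational_invmx; last exact: rational_fundamental.
- by move=> l l0; exact: spectral_gauge_unit.
- exact: rational_spectral_gauge.
- by move=> l l0; exact: fundamental_unit.
Qed.

Lemma transition_intertwines l j : l != 0 ->
  lax_inverse m (b j) l *m transition l (j + 1)
  = transition l j *m lax_inverse m (a (j - (m + d)%:Z)) l.
Proof.
move=> l0; rewrite /transition (negPf l0); set F := fundamental_solution m l b.
have Fu i : frame d F i \in unitmx by exact: fundamental_unit.
have sF : solves m l b F by exact: fundamental_solves.
have gu := spectral_gauge_unit d m l0; set G := spectral_gauge d m l in gu *.
have /solvesE sL := low_coefficients_solves sF; move/solvesE: sF => sF.
have -> : lax_inverse m (b j) l = invmx G *m shift_mx m l (b j) *m G.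
  by rewrite -mulmxA shift_mx_gauge // mulKmx.
rewrite -!mulmxA; congr (_ *m _); rewrite mulKVmx //.
have -> : invmx (frame d F j) = shift_mx m l (b j) *m invmx (frame d F (j + 1)).
  by rewrite -[LHS]mulmx1; apply: (canLR (mulKmx (Fu j))); rewrite mulmxA -sF mulmxV.
rewrite -!mulmxA; congr (_ *m (_ *m _)).
by rewrite -shift_mx_gauge // mulmxA -sL; congr (frame d _ _ *m _); ring.
Qed.

End Data.

Lemma solves_reindex l a k (X : int -> 'cV[C]_k) s : solves m l a X ->
  solves m l (fun j => a (j + s)) (fun j => X (j + s)).
Proof.
move=> sX j; have E (i : int) : j + i + s = j + s + i by rewrite addrAC.
rewrite /high /low E; under eq_bigr do rewrite E.
under [in RHS]eq_bigr do rewrite E.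
exact: sX.
Qed.

Lemma invmx_intertwine k (A B P P' : 'M[C]_k) :
    A \in unitmx -> B \in unitmx -> P \in unitmx -> A *m P' = P *m B ->
  invmx A = P' *m invmx B *m invmx P.
Proof.
move=> Au Bu Pu E; apply: (can_inj (mulKmx Au)).
by rewrite mulmxV // !mulmxA E mulmxK // mulmxV.
Qed.

(** The coefficients a of p need not be those of the lift low b W, hence the
    additional factor [window_diag]. *)
Lemma lax_step p (a b : int -> 'cV[C]_d.+1) :
    twisted_ngon n p -> generic_polygon m p -> generic_polygon m (dented m p) ->
    coefficients n p a -> coefficients n (dented m p) b ->
  exists P : int -> C -> 'M[C]_d.+1, spectral_family n P /\
    for_generic (fun l => forall j, invmx (lax_inverse m (b j) l)
      = P (j + 1) l *m invmx (lax_inverse m (a j) l) *m invmx (P j l)).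
Proof.
move=> pt pg Tpg /(coefficientsE m) [V pV sV] Tb.
have [a' [W D]] := inverse_data_exists pt pg Tpg Tb.
have [u [u0 un uE]] := lift_gauge pt (id_low_lift D) pV.
have Vu := lift_frame_unit pg pV.
have Lu := lift_frame_unit pg (id_low_lift D).
have VE : V = (fun k => u k *: low m b W (k - (m + d)%:Z)) by apply/funext.
have gE : forall j (i : 'I_d.+1), u (j + i%:Z) * a j i 0
    = u (j + d.+1%:Z) * a' (j - (m + d)%:Z) i 0.
  rewrite VE in sV; apply: (gauge_coefficients Lu _ sV).
  exact: (solves_reindex _ (id_low_solves D)).
have Uu j := window_diag_unit d j u0.
exists (fun j l => transition b l j *m window_diag d u j); split.
  split=> [j l|j|].
  - rewrite (transition_periodic D); congr (_ *m _).
    by congr diag_mx; apply/rowP => i; rewrite !mxE addrAC un.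
  - apply: rational_mxM; [exact: (transition_rational D) | exact: rational_mx_const].
  - by apply: generic_off0 => l _ j; rewrite unitmx_mul Uu (transition_unit D).
apply: generic_off0 => l l0 j; apply: invmx_intertwine.
- apply: lax_inverse_unit => //; exact: (lead_neq0 hm (id_solves D) (id_unit D)).
- apply: lax_inverse_unit => //; exact: (lead_neq0 hm sV Vu).
- by rewrite unitmx_mul Uu (transition_unit D).
rewrite mulmxA (transition_intertwines D _ l0) -!mulmxA.
by rewrite (gauge_lax_inverse m l j gE).
Qed.

End InverseMap.

(** * Scaling invariance *)

Section Scaling.
Variables (C : fieldType) (d m n : nat).
Hypotheses (hm : (m < d)%N) (hn : (0 < n)%N).
Implicit Types (c : C) (a b : int -> 'cV[C]_d.+1) (p q : polygon C d)
  (V W X Y Z : int -> 'cV[C]_d.+1).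

(** The difference w_(i+1) - w_i is 1 except at i = m, and w_0 = 0: the last condition is
    forced, as the determinant of the monodromy is up to sign the product of the
    coefficients of index 0 over a period. *)
Definition weight (i : 'I_d.+1) : int := if (i <= m)%N then i%:Z else i%:Z - d.+1%:Z.

Definition scale_coef (c : C) a j : 'cV[C]_d.+1 := \col_i (c ^ weight i * a j i 0).

Lemma scale_coef_solves c a k (X : int -> 'cV[C]_k) : c != 0 ->
  solves m 1 (scale_coef c a) X <-> solves m (c ^+ d.+1) a (fun j => c ^ j *: X j).
Proof.
move=> c0.
have highE j : high m a (fun j => c ^ j *: X j) j
    = c ^ (j + d.+1%:Z) *: high m (scale_coef c a) X j.
  rewrite /high scalerBr scaler_sumr; congr (_ - _); apply: eq_bigr => i im.
  have E : a j i 0 * c ^ (j + i%:Z) = c ^ (j + d.+1%:Z) * (c ^ weight i * a j i 0) :> C.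
    rewrite /weight (negPf im) mulrA -expfzDr // mulrC.
    by congr (_ ^ _ * _); ring.
  by rewrite mxE !scalerA E.
have lowE j : c ^+ d.+1 *: low m a (fun j => c ^ j *: X j) j
    = c ^ (j + d.+1%:Z) *: low m (scale_coef c a) X j.
  rewrite /low !scaler_sumr; apply: eq_bigr => i im.
  have E : c ^+ d.+1 * (a j i 0 * c ^ (j + i%:Z))
      = c ^ (j + d.+1%:Z) * (c ^ weight i * a j i 0) :> C.
    rewrite /weight im exprnP mulrCA -expfzDr // [RHS]mulrA -expfzDr // mulrC.
    by congr (_ ^ _ * _); ring.
  by rewrite mxE !scalerA -[in LHS]mulrA E.
split=> H j; last first.
  apply: (scalerI (expfz_neq0 (j + d.+1%:Z) c0)).
  by rewrite scale1r -highE H lowE.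
by rewrite highE H scale1r lowE.
Qed.

(** The notion of scaled polygons only provides some pair of coefficients; by rescaling the
    lifts of p and q by the same periodic factors, the coefficients of p can
    be prescribed. *)
Lemma scaled_lift c p q a V : twisted_ngon n p -> generic_polygon m p ->
    scaled n weight c p q -> Defs.lift n p V -> solves m 1 a V ->
  exists2 Y : int -> 'cV[C]_d.+1, Defs.lift n q Y & solves m 1 (scale_coef c a) Y.
Proof.
move=> pt pg [a0 [b0 [/(coefficientsE m) [V0 pV0 sV0]]]].
move=> /(coefficientsE m) [Y0 qY0 sY0] ab pV sV.
have [u [u0 un uE]] := lift_gauge pt pV0 pV.
have gE : forall j (i : 'I_d.+1), u (j + i%:Z) * a j i 0 = u (j + d.+1%:Z) * a0 j i 0.
  have VE : V = (fun k => u k *: V0 k) by apply/funext.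
  by rewrite VE in sV; apply: gauge_coefficients sV; first exact: lift_frame_unit pg pV0.
exists (fun k => u k *: Y0 k); last first.
  by apply: gauge_solves sY0 => j i; rewrite mxE ab mulrCA gE mulrCA.
by case: qY0 => qY YM; split=> k; rewrite ?line_scale // un YM scalemxAr.
Qed.

(** For inverse Lax matrices, conjugation by E = diag(c ^ (- w_i)) takes the one of a at
    l = c ^ (d + 1) to c times the one of the scaled coefficients at l = 1. *)
Lemma scaled_gauge_equiv c p q a b : c != 0 -> twisted_ngon n p -> generic_polygon m p ->
    twisted_ngon n q -> generic_polygon m q -> scaled n weight c p q ->
    coefficients n p a -> coefficients n q b ->
  gauge_equiv n (fun j => invmx (lax_inverse m (a j) (c ^+ d.+1)))
                (fun j => invmx (lax_inverse m (b j) 1)).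
Proof.
move=> c0 pt pg qt qg spq /(coefficientsE m) [V pV sV] /(coefficientsE m) [Z qZ sZ].
have [Y qY sY] := scaled_lift pt pg spq pV sV.
have [u [u0 un uE]] := lift_gauge qt qY qZ.
have gE : forall j (i : 'I_d.+1), u (j + i%:Z) * b j i 0
    = u (j + d.+1%:Z) * scale_coef c a j i 0.
  have ZE : Z = (fun k => u k *: Y k) by apply/funext.
  by rewrite ZE in sZ; apply: gauge_coefficients sZ => //; exact: lift_frame_unit qg qY.
have aE := lead_neq0 hm sV (lift_frame_unit pg pV).
have bE := lead_neq0 hm sZ (lift_frame_unit qg qZ).
pose E : 'M[C]_d.+1 := diag_mx (\row_i c ^ (- weight i)).
have Eu : E \in unitmx by apply: diag_mx_unit => i; rewrite mxE expfz_neq0.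
have Uu j := window_diag_unit d j u0.
have EN j : lax_inverse m (a j) (c ^+ d.+1) *m E
    = c *: (E *m lax_inverse m (scale_coef c a j) 1).
  apply/matrixP => r s; rewrite mul_entry_diag [RHS]mxE mul_diag_entry !mxE.
  have [sd|sd] := eqVneq (s : nat) d.
    have cE : c ^ (- weight s) = c.
      rewrite /weight sd leqNgt hm /=; have -> : - (d%:Z - d.+1%:Z) = 1 by lia.
      exact: expr1z.
    have cK : c ^ (- weight r) * (c ^ weight r * a j r 0) = a j r 0 :> C.
      by rewrite mulrA -expfzDr // addNr expr0z mul1r.
    by rewrite cE cK mulrC.
  have [rs|_] := eqVneq (r : nat) s.+1; last by rewrite mulr0 mul0r mulr0.
  have cS : c * c ^ (- weight r) = c ^ (1 - weight r) by rewrite expfzDr // expr1z.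
  rewrite if_same mulr1 cS /weight rs.
  have [sm|sm] := eqVneq (s : nat) m.
    by rewrite sm leqnn ltnn exprnP -expfzDr //; congr (_ ^ _); lia.
  rewrite mul1r; congr (_ ^ _); case: (leqP s m) => h1; case: (leqP s.+1 m) => h2; lia.
exists c^-1, (fun j => E *m window_diag d u j); split=> [|j|j|j].
- by rewrite invr_neq0.
- by rewrite unitmx_mul Eu Uu.
- by congr (_ *m diag_mx _); apply/rowP => i; rewrite !mxE addrAC un.
have Nu : lax_inverse m (b j) 1 \in unitmx by rewrite lax_inverse_unit ?oner_neq0.
have cNu : c *: lax_inverse m (b j) 1 \in unitmx by rewrite unitmxZ ?unitfE.
rewrite scalemxAl scalemxAr -invmxZ //; apply: invmx_intertwine => //.
- by rewrite lax_inverse_unit ?expf_neq0.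
- by rewrite unitmx_mul Eu Uu.
by rewrite mulmxA EN -scalemxAl -!mulmxA -(gauge_lax_inverse _ _ _ gE) !scalemxAr.
Qed.

Lemma scale_exprz c k l (M : 'M[C]_(k, l)) (s t : int) : c != 0 ->
  c ^ s *: (c ^ t *: M) = c ^ (s + t) *: M.
Proof. by move=> c0; rewrite scalerA -expfzDr. Qed.

Lemma exprz_gauge_solves c a Y : c != 0 -> solves m (c ^+ d.+1) a Y ->
  solves m 1 (scale_coef c a) (fun j => c ^ (- j) *: Y j).
Proof.
move=> c0 sY; apply/scale_coef_solves => //.
have -> : (fun j => c ^ j *: (c ^ (- j) *: Y j)) = Y => //.
by apply/funext => j; rewrite scale_exprz // addrN expr0z scale1r.
Qed.

Lemma frame_exprz_unit c Y : c != 0 -> (forall j, frame d Y j \in unitmx) ->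
  forall j, frame d (fun i => c ^ i *: Y i) j \in unitmx.
Proof.
move=> c0 Yu j; have -> : frame d (fun i => c ^ i *: Y i) j
    = frame d Y j *m window_diag d (fun i => c ^ i) j.
  by apply/matrixP => r i; rewrite mul_entry_diag !mxE mulrC.
by rewrite unitmx_mul Yu window_diag_unit // => k; rewrite expfz_neq0.
Qed.

Lemma frame_exprzN_unit c Y : c != 0 -> (forall j, frame d Y j \in unitmx) ->
  forall j, frame d (fun i => c ^ (- i) *: Y i) j \in unitmx.
Proof.
move=> c0 Yu; have -> : (fun i => c ^ (- i) *: Y i) = (fun i => c^-1 ^ i *: Y i).
  by apply/funext => i; rewrite exprz_inv.
by apply: frame_exprz_unit; rewrite ?invr_eq0.
Qed.

Section ScaledDented.
Variables (c : C) (p : polygon C d) (a b : int -> 'cV[C]_d.+1) (W : int -> 'cV[C]_d.+1).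
Hypotheses (c0 : c != 0) (pt : twisted_ngon n p) (pg : generic_polygon m p).
Hypothesis D : inverse_data m n p a b W.
Let l0 : c ^+ d.+1 != 0 := expf_neq0 _ c0.
Local Notation tau := (m + d)%:Z.

(** After multiplying its j-th vector by c ^ j, a lift Y of q solves the recurrence
    of (a, l) with l = c ^ (d + 1), so it is low b X for a solution X of (b, l), and
    X spans the image of q by [dented_vertex].  Undoing the factor c ^ j turns b
    into its scaled version. *)
Lemma scaled_dented q : twisted_ngon n q -> generic_polygon m q ->
  scaled n weight c p q -> scaled n weight c (dented m p) (dented m q).
Proof.
move=> qt qg spq.
have [Y qY sY] := scaled_lift pt pg spq (id_low_lift D)
  (solves_reindex (- tau) (id_low_solves D)).
pose Z j := c ^ j *: Y (j + tau).
have sZ : solves m (c ^+ d.+1) a Z.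
  apply/scale_coef_solves => //; have := solves_reindex tau sY.
  suff -> : (fun j => scale_coef c (fun i => a (i - tau)) (j + tau)) = scale_coef c a by [].
  by apply/funext => j; apply/colP => i; rewrite !mxE addrK.
have Zu j : frame d Z j \in unitmx.
  apply: (frame_exprz_unit (Y := fun j => Y (j + tau)) c0) => i.
  by rewrite frame_reindex; exact: lift_frame_unit qg qY _.
have [X [sX Xu XZ]] := low_onto hm D l0 sZ Zu.
have XZ' : low m b X = Z by apply/funext.
have [h [hX hZ]] := solution_monodromy hm D l0 sX Xu.
have hE : h = c ^ n%:Z *: monodromy q.
  apply: (can_inj (mulmxK (Zu 0))); rewrite -!frame_mul; congr (frame d _ _).
  apply/funext => j; rewrite -XZ' -hZ XZ' /Z addrAC qY.2 -scalemxAl -scalemxAr scale_exprz //.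
  by congr (_ ^ _ *: _); rewrite addrC.
exists b, (scale_coef c b); split=> [||j i]; last by rewrite mxE.
  by apply/(coefficientsE m); exists W; [exact: id_lift D | exact: id_solves D].
apply/(coefficientsE m); exists (fun j => c ^ (- j) *: X j); last exact: exprz_gauge_solves.
split=> k; last first.
  rewrite hX hE -scalemxAl -scalemxAr scale_exprz //.
  by congr (_ ^ _ *: _); ring.
rewrite line_scale ?expfz_neq0 //; apply: (dented_vertex hm l0 Xu sX) => [j|j].
  by rewrite XZ'.
by rewrite XZ' qY.1 line_scale // expfz_neq0.
Qed.

(** Apply low b to a fundamental solution of (b, l), with l = c ^ (d + 1).  Its
    monodromy has determinant 1 because scaling does not change the coefficients of index 0,
    which give the ratio of consecutive determinants of windows. *)
Lemma scaled_exists : exists q : polygon C d,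
  [/\ twisted_ngon n q, generic_polygon m q & scaled n weight c p q].
Proof.
pose b0 := lead_neq0 hm (id_solves D) (id_unit D).
pose X := fundamental_solution m (c ^+ d.+1) b.
have sX : solves m (c ^+ d.+1) b X by exact: fundamental_solves.
have Xu j : frame d X j \in unitmx by exact: fundamental_unit.
have [h [hX hL]] := solution_monodromy hm D l0 sX Xu.
have Lu := low_coefficients_unit hm D l0 sX Xu.
have sL := exprz_gauge_solves c0 (low_coefficients_solves hm D sX).
have Yu := frame_exprzN_unit c0 Lu.
pose L j := c ^ (- j) *: low m b X j; rewrite -/L in sL Yu.
pose Y j := L (j - tau).
pose V j := low m b W (j - tau).
pose q := Polygon (fun k => <[Y k]>%VS) (c ^ (- n%:Z) *: h).
have LM k : L (k + n%:Z) = monodromy q *m L k.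
  rewrite /L hL -scalemxAl -scalemxAr scale_exprz //.
  by congr (_ ^ _ *: _); ring.
have YM k : Y (k + n%:Z) = monodromy q *m Y k by rewrite /Y addrAC LM.
have Y0 k : Y k != 0.
  apply/eqP => Yk; have := Yu (k - tau); rewrite unitmxE.
  suff -> : \det (frame d L (k - tau)) = 0 by rewrite unitr0.
  rewrite (expand_det_col _ ord0) big1 // => i _.
  by rewrite mxE addr0 -/(Y k) Yk mxE mul0r.
have detE j : \det (frame d L j) * \det (frame d (low m b W) 0)
    = \det (frame d (low m b W) j) * \det (frame d L 0).
  have /solvesE HL := sL; have /solvesE HV := id_low_solves D.
  have detS i : \det (shift_mx m 1 (scale_coef c a i)) = \det (shift_mx m 1 (a i)).
    by rewrite !det_shift_mx ?oner_neq0 // mxE /weight /= expr0z mul1r.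
  have detn i : \det (shift_mx m 1 (a i)) != 0.
    rewrite -unitfE -unitmxE shift_mx_unit ?oner_neq0 //.
    exact: (lead_neq0 hm (id_low_solves D) (id_low_unit D)).
  move: j; apply: int_step_ind => [|j]; first by rewrite mulrC.
  rewrite HL HV !det_mulmx detS.
  split=> E; first by rewrite mulrAC E mulrAC.
  by apply: (mulIf (detn j)); rewrite mulrAC E mulrAC.
have qt : twisted_ngon n q.
  split=> [|k|k] /=.
  - have frameM X' (M : 'M[C]_d.+1) : (forall k, X' (k + n%:Z) = M *m X' k) ->
        \det (frame d X' (0 + n%:Z)) = \det M * \det (frame d X' 0).
      move=> XM; rewrite -det_mulmx -frame_mul -frame_reindex; congr (\det (frame d _ _)).
      exact/funext.
    have := detE (0 + n%:Z); rewrite (frameM _ _ LM).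
    have WM k : low m b W (k + n%:Z) = monodromy p *m low m b W k.
      by have := (id_low_lift D).2 (k + tau); rewrite addrAC !addrK.
    rewrite (frameM _ _ WM); case: pt => -> _ _; rewrite mul1r mulrAC [RHS]mulrC.
    move=> E; apply: (mulIf (x := \det (frame d L 0) * \det (frame d (low m b W) 0))).
      by rewrite mulf_neq0 // -unitfE -unitmxE // (id_low_unit D).
    by rewrite mul1r mulrA mulrAC E mulrC.
  - by rewrite dim_vline Y0.
  - by rewrite image_line -YM.
have qY : Defs.lift n q Y by [].
have Xq k : vertex (dented m q) k = <[X k]>%VS.
  apply: (dented_vertex hm l0 Xu sX) => // j.
  by rewrite /= /Y addrK line_scale // expfz_neq0.
exists q; split=> //.
  split=> k; last first.
    rewrite Xq dim_vline; suff -> : X k != 0 by [].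
    apply/eqP => Xk; have := Xu k; rewrite unitmxE.
    suff -> : \det (frame d X k) = 0 by rewrite unitr0.
    rewrite (expand_det_col _ ord0) big1 // => i _.
    by rewrite mxE addr0 Xk mxE mul0r.
  have Yu' : frame d Y k \in unitmx by rewrite frame_reindex.
  by have /frame_unitP := Yu'.
exists (fun j => a (j - tau)), (scale_coef c (fun j => a (j - tau))).
split=> [||j i]; last by rewrite mxE.
  apply/(coefficientsE m); exists V; first exact: id_low_lift D.
  exact: (solves_reindex _ (id_low_solves D)).
apply/(coefficientsE m); exists Y => //.
have := solves_reindex (- tau) sL.
suff -> : (fun j => scale_coef c a (j + - tau)) = scale_coef c (fun i => a (i - tau)) by [].
by apply/funext => j; apply/colP => i; rewrite !mxE.
Qed.

End ScaledDented.

Lemma dented_scaling_invariant : scaling_invariant C m n weight.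
Proof.
move=> c p c0 pt pg Tpg.
have [b Tb] := coefficients_exist hn (dented_twisted pt pg) Tpg.
have [a [W D]] := inverse_data_exists hm hn pt pg Tpg Tb.
by split=> [|q qt qg]; [exact: scaled_exists D | exact: scaled_dented D _ qt qg].
Qed.

End Scaling.

(** * Normalised coordinates, projective equivalence and the theorem *)

Section Coordinates.
Variable C : closedFieldType.
Implicit Types (F : nat -> C) (E : int -> C).

Lemma root_exists (x : C) k : (0 < k)%N -> exists s, s ^+ k = x.
Proof.
move=> k0; have [s sE] := GRing.solve_monicpoly k (fun i => if i is 0%N then x else 0) k0.
exists s; rewrite sE; case: k k0 {sE} => // k _.
by rewrite big_ord_recl big1 /= => [|i _]; rewrite ?mul0r // mulr1 addr0.
Qed.

Lemma prod_blocks N q F :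
  \prod_(s < N * q) F s = \prod_(i < N) \prod_(k < q) F (i * q + k)%N.
Proof.
elim: N => [|N IHN]; first by rewrite mul0n !big_ord0.
by rewrite mulSnr big_split_ord /= IHN big_ord_recr.
Qed.

Lemma prod_period E n : (forall j, E (j + n%:Z) = E j) ->
  forall j, \prod_(s < n) E (j + s%:Z) = \prod_(s < n) E s%:Z.
Proof.
move=> En; apply: int_step_ind => [|j]; first by under eq_bigr do rewrite add0r.
suff -> : \prod_(s < n) E (j + 1 + s%:Z) = \prod_(s < n) E (j + s%:Z) by [].
case: n En => [|n] En; first by rewrite !big_ord0.
rewrite big_ord_recr [RHS]big_ord_recl /= mulrC; congr (_ * _).
  by rewrite addr0 -(En j); congr E; lia.
by apply: eq_bigr => i _; rewrite /bump /= add1n; congr E; lia.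
Qed.

(** If e k = f n + 1, then u_j ... u_(j+ek-1) is a product of e values of E on one hand,
    and on the other hand u_j times the f-th power of r = u_0 ... u_(n-1), where
    r ^ k is the product of E over a period.  Solving for u_j gives the witness; this
    is where coprimality is used. *)
Lemma window_product_exists E n k : (0 < k)%N -> coprime n k ->
    (forall j, E j != 0) -> (forall j, E (j + n%:Z) = E j) ->
  exists u : int -> C, [/\ forall j, u j != 0, forall j, u (j + n%:Z) = u j
    & forall j, \prod_(i < k) u (j + i%:Z) = E j].
Proof.
move=> k0 nk E0 En; have [[e f] /= ef] : exists u, (u.1 * k - u.2 * n)%N = 1%N.
  by apply/coprimeP => //; rewrite coprime_sym.
have {}ef : (e * k = (f * n).+1)%N by lia.
have [r rE] := root_exists (\prod_(s < n) E s%:Z) k0.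
have r0 : r != 0.
  have : r ^+ k != 0 by rewrite rE; apply/prodf_neq0 => i _; exact: E0.
  by rewrite expf_eq0 k0.
exists (fun j => \prod_(i < e) E (j + (i * k)%:Z) / r ^+ f); split=> j.
- by rewrite mulf_neq0 ?invr_eq0 ?expf_neq0 //; apply/prodf_neq0 => i _; exact: E0.
- by congr (_ / _); apply: eq_bigr => i _; rewrite addrAC En.
rewrite big_split /= prodr_const card_ord exchange_big /=.
have -> : \prod_(i < e) \prod_(s < k) E (j + s%:Z + (i * k)%:Z)
    = \prod_(s < e * k) E (j + s%:Z).
  rewrite (prod_blocks e k (fun s => E (j + s%:Z))).
  by apply: eq_bigr => i _; apply: eq_bigr => s _; congr E; lia.
rewrite ef big_ord_recl addr0 /=.
have -> : \prod_(s < f * n) E (j + (lift ord0 s)%:Z) = (r ^+ f) ^+ k.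
  rewrite exprAC rE (prod_blocks f n (fun s => E (j + s.+1%:Z))).
  rewrite -[in RHS](card_ord f) -prodr_const; apply: eq_bigr => i _.
  rewrite -(prod_period En (j + 1 + (i * n)%:Z)); apply: eq_bigr => s _.
  by congr E; lia.
by rewrite exprVn mulfK // !expf_neq0.
Qed.

Variables (d m n : nat).
Hypotheses (hm : (m < d)%N) (hn : (0 < n)%N).
Implicit Types (p q : polygon C d) (V : int -> 'cV[C]_d.+1).

Definition full_coefficients (a : 'cV[C]_d) : 'cV[C]_d.+1 :=
  \col_i (if unlift ord0 i is Some i' then a i' 0 else (-1) ^+ d).

(** The entry (-1) ^ d of the normalised Lax matrix is the coefficient of index 0. *)
Lemma lax_matrixE (a : 'cV[C]_d) l :
  lax_matrix m a l = invmx (lax_inverse m (full_coefficients a) l).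
Proof.
congr invmx; apply/matrixP => r s; rewrite castmxE /=.
have [r' rE|r' rE] := split_ordP (cast_ord (esym (erefl (1 + d)%N)) r);
have [s' sE|s' sE] := split_ordP (cast_ord (esym (addn1 d)) s);
have := congr1 val rE; have := congr1 val sE; rewrite /= ?ord1 ?addn0 => sv rv;
rewrite rE sE ?block_mxEul ?block_mxEur ?block_mxEdl ?block_mxEdr !mxE sv.
- by rewrite rv ltn_eqF.
- rewrite !eqxx ?mulr1n; have -> : r = ord0 by exact: val_inj.
  by rewrite unlift_none !ord1.
- rewrite (ltn_eqF (ltn_ord s')) rv add1n eqSS val_eqE.
  by have [->|] := eqVneq r' s'; rewrite ?mulr1n ?mulr0n.
- rewrite eqxx ord1; have -> : r = lift ord0 r' by exact: val_inj.
  by rewrite liftK.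
Qed.

(** Multiplying V by u multiplies the determinants of the windows by the products of
    d + 1 consecutive values of u. *)
Lemma coordinates_exist p : coprime n d.+1 -> twisted_ngon n p -> generic_polygon m p ->
  exists a, coordinates n p a.
Proof.
move=> nd pt pg; have [V pV] := lift_exists hn pt.
have Vu := lift_frame_unit pg pV.
have D0 j : \det (frame d V j) != 0 by have := Vu j; rewrite unitmxE unitfE.
have [||u [u0 un uE]] :=
  @window_product_exists (fun j => (\det (frame d V j))^-1) n d.+1 isT nd.
- by move=> j; rewrite invr_eq0.
- by move=> j; rewrite (frame_shift pV.2) det_mulmx; case: pt => -> _ _; rewrite mul1r.
pose W k := u k *: V k.
have WE j : frame d W j = frame d V j *m window_diag d u j.
  by apply/matrixP => r i; rewrite mul_entry_diag !mxE mulrC.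
have detW j : \det (frame d W j) = 1.
  rewrite WE det_mulmx det_diag; under eq_bigr do rewrite mxE.
  by rewrite uE divff.
have Wu j : frame d W j \in unitmx by rewrite unitmxE detW unitr1.
have [b sW] := solution_exists m Wu.
have lead j : b j 0 0 = (-1) ^+ d.
  have /solvesE/(_ j)/(congr1 determinant) := sW.
  rewrite det_mulmx !detW mul1r det_shift_mx ?oner_neq0 // mulr1 => E.
  by rewrite -[LHS](signrMK d) -E mulr1.
exists (fun j => \col_i b j (lift ord0 i) 0), W; split=> //.
  case: pV => pV VM; split=> k; first by rewrite pV line_scale.
  by rewrite /W un VM scalemxAr.
move=> j; move/solves1E: (sW) => ->; rewrite big_ord_recl addr0 lead addrC.
by congr (_ + _); apply: eq_bigr => i _; rewrite mxE.
Qed.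

Lemma coordinates_coefficients p a : coordinates n p a ->
  coefficients n p (fun j => full_coefficients (a j)).
Proof.
move=> [V [pV _ sV]]; exists V => // j; rewrite sV big_ord_recl addr0 addrC mxE unlift_none.
by congr (_ + _); apply: eq_bigr => i _; rewrite mxE liftK.
Qed.

Lemma lift_image (g : 'M[C]_d.+1) p q V : g \in unitmx ->
    (forall k, vertex q k = (linfun (mulmx g) @: vertex p k)%VS) ->
    monodromy q = g *m monodromy p *m invmx g ->
  Defs.lift n p V -> Defs.lift n q (fun k => g *m V k).
Proof.
move=> gu qv qM [pV VM]; split=> k; first by rewrite qv pV image_line.
by rewrite qM VM -!mulmxA mulKmx.
Qed.

Lemma proj_equiv_sym p q : proj_equiv p q -> proj_equiv q p.
Proof.
move=> [g [detg qv qM]].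
have gu : g \in unitmx by rewrite unitmxE detg unitr1.
exists (invmx g); split=> [|k|]; first by rewrite det_inv detg invr1.
  rewrite qv -limg_comp.
  have -> : (linfun (mulmx (invmx g)) \o linfun (@mulmx C d.+1 d.+1 1 g) = \1)%VF.
    by apply/lfunP => x; rewrite comp_lfunE !lfunE /= mulKmx.
  by rewrite lim1g.
by rewrite qM invmxK -!mulmxA mulVmx // mulmx1 mulKmx.
Qed.

Lemma coefficients_proj_equiv p q a :
  proj_equiv p q -> coefficients n p a -> coefficients n q a.
Proof.
move=> [g [detg qv qM]] /(coefficientsE m) [V pV sV].
have gu : g \in unitmx by rewrite unitmxE detg unitr1.
apply/(coefficientsE m); exists (fun k => g *m V k); first exact: lift_image qM pV.
exact: solves_mul.
Qed.

Lemma coordinates_proj_equiv p q a :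
  proj_equiv p q -> coordinates n p a -> coordinates n q a.
Proof.
move=> [g [detg qv qM]] [V [pV dV sV]].
have gu : g \in unitmx by rewrite unitmxE detg unitr1.
exists (fun k => g *m V k); split=> [|j|j]; first exact: lift_image qM pV.
  rewrite -[X in \det X]/(frame d (fun k => g *m V k) j) frame_mul det_mulmx detg mul1r.
  exact: dV.
rewrite sV mulmxDr mulmx_sumr -scalemxAr; congr (_ + _).
by apply: eq_bigr => i _; rewrite scalemxAr.
Qed.

(** Two lifts with the same coefficients differ by a constant matrix g, which the choice of
    a root of its determinant normalises. *)
Lemma coefficients_faithful p q a : twisted_ngon n p -> generic_polygon m p ->
    twisted_ngon n q -> generic_polygon m q ->
  coefficients n p a -> coefficients n q a -> proj_equiv p q.
Proof.
move=> pt pg qt qg /(coefficientsE m) [V pV sV] /(coefficientsE m) [Y qY sY].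
have Vu := lift_frame_unit pg pV; have Yu := lift_frame_unit qg qY.
have a0 := lead_neq0 hm sV Vu.
have [g gE] := solution_factor hm (oner_neq0 C) a0 sV (Vu 0) sY.
have {}gE : Y = (fun j => g *m V j) by apply/funext.
have gu : g \in unitmx.
  by have := Yu 0; rewrite gE frame_mul unitmx_mul => /andP[].
have [s sE] := root_exists (\det g) (ltn0Sn d).
have s0 : s != 0.
  by apply: contraTneq gu => s0; rewrite unitmxE -sE s0 expr0n unitr0.
have qM : monodromy q = g *m monodromy p *m invmx g.
  apply: (canRL (mulmxK gu)); apply: (can_inj (mulmxK (Vu 0))).
  rewrite -!mulmxA -!frame_mul; congr (frame d _ 0); apply/funext => k.
  by rewrite -pV.2 -[LHS]/(_ *m (fun j => g *m V j) k) -gE -qY.2 gE.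
exists (s^-1 *: g); split=> [|k|].
- by rewrite detZ exprVn sE mulVf // -unitfE -unitmxE.
- by rewrite qY.1 pV.1 image_line gE -scalemxAl line_scale // invr_eq0.
- rewrite invmxZ ?unitmxZ ?unitfE ?invr_eq0 // invrK -!scalemxAl -scalemxAr.
  by rewrite scalerA mulVf // scale1r.
Qed.

(** The argument is the same for any projectively invariant choice of coefficients, be they
    arbitrary (any n) or normalised (n prime to d + 1). *)
Section Selection.
Variable coef : polygon C d -> int -> 'cV[C]_d.+1.
Hypothesis coefP : forall p, twisted_ngon n p -> generic_polygon m p ->
  coefficients n p (coef p).
Hypothesis coef_equiv : forall p q, proj_equiv p q -> coef p = coef q.

Lemma coef_lead_neq0 p : twisted_ngon n p -> generic_polygon m p ->
  forall j, coef p j 0 0 != 0.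
Proof.
move=> pt pg; have /(coefficientsE m) [V pV sV] := coefP pt pg.
exact: (lead_neq0 hm sV (lift_frame_unit pg pV)).
Qed.

Lemma iter_dented_twisted p t : twisted_ngon n p ->
    (forall s, (s < t)%N -> generic_polygon m (iter s (dented m) p)) ->
  twisted_ngon n (iter t (dented m) p).
Proof.
move=> pt; elim: t => [//|t IHt] tg; apply: dented_twisted; last exact: tg.
by apply: IHt => s st; apply: tg; exact: ltnW.
Qed.

Lemma twisted_lax_representation : lax_representation m n (@twisted_ngon C d n)
  (fun p j l => invmx (lax_inverse m (coef p j) l)).
Proof.
split.
- move=> p pt pg; have c0 := coef_lead_neq0 pt pg.
  have /(coefficientsE m) [V pV sV] := coefP pt pg.
  have cn := coefficients_periodic pV.2 (lift_frame_unit pg pV) sV.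
  have Nu l j : l != 0 -> lax_inverse m (coef p j) l \in unitmx.
    by move=> l0; exact: lax_inverse_unit.
  split=> [j l|j|]; first by rewrite cn.
    by apply: rational_invmx; [move=> l; exact: Nu | exact: rational_lax_inverse].
  by apply: generic_off0 => l l0 j; rewrite unitmx_inv Nu.
- move=> p q pt pg qt qg; split=> [/coef_equiv -> //|E].
  suff cE : coef p = coef q.
    by apply: (coefficients_faithful pt pg qt qg (coefP pt pg)); rewrite cE; exact: coefP.
  apply/funext => j; apply/colP => r.
  have := congr1 (fun A => invmx A r ord_max) (E j 1); rewrite !invmxK.
  by rewrite !mxE eqxx.
- move=> p pt.
  have stepP t : exists P : int -> C -> 'M[C]_d.+1,
      (forall s, (s <= t.+1)%N -> generic_polygon m (iter s (dented m) p)) ->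
      spectral_family n P /\ for_generic (fun l => forall j,
        invmx (lax_inverse m (coef (iter t.+1 (dented m) p) j) l)
        = P (j + 1) l *m invmx (lax_inverse m (coef (iter t (dented m) p) j) l)
          *m invmx (P j l)).
    have [tg|ng] := pselect (forall s, (s <= t.+1)%N ->
        generic_polygon m (iter s (dented m) p)); last by exists (fun _ _ => 1%:M).
    have tt : twisted_ngon n (iter t (dented m) p).
      by apply: iter_dented_twisted => // s st; apply: tg; lia.
    have tg0 := tg t (leqnSn t); have tg1 := tg t.+1 (leqnn _).
    have [P HP] := lax_step hm hn tt tg0 tg1 (coefP tt tg0)
      (coefP (dented_twisted tt tg0) tg1).
    by exists P.
  by have [P PE] := choice stepP; exists P.
- exists (weight m (d := d)), d.+1; split=> //.
  + by exists ord_max; rewrite /weight /= leqNgt hm /=; lia.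
  + exact: dented_scaling_invariant.
  + move=> c p q c0 pt pg qt qg spq.
    exact: scaled_gauge_equiv spq (coefP pt pg) (coefP qt qg).
Qed.

Lemma closed_lax_representation : lax_representation m n (@closed_ngon C d n)
  (fun p j l => invmx (lax_inverse m (coef p j) l)).
Proof.
have [fam faith equ [w [e [w0 e0 winv wg]]]] := twisted_lax_representation.
split=> [p []|p q [? _] ? [? _]|p []|]; [by auto | exact: faith | by auto |].
by exists w, e; split=> // c p q c0 [pt _]; exact: wg.
Qed.

End Selection.
End Coordinates.

Theorem theorem2p6 (R : realType) (d m n : nat)
    (hd : (2 <= d)%N) (hm : (1 <= m <= d.-1)%N) (hn : (0 < n)%N) :
  (exists L : polygon R[i] d -> int -> R[i] -> 'M[R[i]]_d.+1,
      lax_representation m n (@twisted_ngon R[i] d n) L /\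
      lax_representation m n (@closed_ngon R[i] d n) L) /\
  (coprime n d.+1 ->
      let L := fun (p : polygon R[i] d) (j : int) (l : R[i]) =>
                 lax_matrix m (ngon_coord n p j) l in
      lax_representation m n (@twisted_ngon R[i] d n) L /\
      lax_representation m n (@closed_ngon R[i] d n) L).
Proof.
have md : (m < d)%N by lia.
split=> [|nd /=].
  pose coef (p : polygon R[i] d) := xget (fun=> 0) [set a | coefficients n p a]%classic.
  have coefP p : twisted_ngon n p -> generic_polygon m p -> coefficients n p (coef p).
    move=> pt pg; have [a pa] := coefficients_exist hn pt pg.
    by rewrite /coef; case: xgetP => [? _ //|/(_ a)/(_ pa)].
  have coef_equiv p q : proj_equiv p q -> coef p = coef q.
    move=> pq; congr xget; apply/seteqP; split=> a; apply: coefficients_proj_equiv => //.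
    exact: proj_equiv_sym.
  exists (fun p j l => invmx (lax_inverse m (coef p j) l)).
  by split; [exact: twisted_lax_representation | exact: closed_lax_representation].
pose coef (p : polygon R[i] d) j := full_coefficients (ngon_coord n p j).
have coefP p : twisted_ngon n p -> generic_polygon m p -> coefficients n p (coef p).
  move=> pt pg; apply: coordinates_coefficients.
  have [a pa] := coordinates_exist md hn nd pt pg.
  by rewrite /ngon_coord; case: xgetP => [? _ //|/(_ a)/(_ pa)].
have coef_equiv p q : proj_equiv p q -> coef p = coef q.
  move=> pq; rewrite /coef; suff -> : ngon_coord n p = ngon_coord n q by [].
  congr xget; apply/seteqP; split=> a; apply: coordinates_proj_equiv => //.
  exact: proj_equiv_sym.
have -> : (fun (p : polygon R[i] d) j l => lax_matrix m (ngon_coord n p j) l)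
    = (fun p j l => invmx (lax_inverse m (coef p j) l)).
  by apply/funext => p; apply/funext => j; apply/funext => l; rewrite lax_matrixE.
by split; [exact: twisted_lax_representation | exact: closed_lax_representation].
Qed.
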